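(* For every choice of primitive admissible parameters $(\delta,K_1,K_2,C_0,C_1)$, the class $\mathcal A^\delta_{K_1,K_2,C_0,C_1}$ has coherent EPPA.
   Context: $\mathcal A^\delta_{K_1,K_2,C_0,C_1}$ is the class of finite metric spaces with integer distances in $\{1,\dots,\delta\}$ such that for every triangle with perimeter $p$ and shortest side $m$: if $p$ odd then $2K_1<p<2K_2+2m$ and $p<C_1$; if $p$ even then $p<C_0$. With $C=\min(C_0,C_1)$, $C'=\max(C_0,C_1)$, parameters are primitive admissible if: $3\le\delta<\infty$; $1\le K_1\le K_2\le 2\delta$; $2\delta<C_0,C_1\le3\delta+2$, $C_0$ even, $C_1$ odd; $C_0,C_1\ge 2\delta+2$; and either (II) $C\le 2\delta+K_1$, $C=2K_1+2K_2+1$, $K_1+K_2\ge\delta$, $K_1+2K_2\le 2\delta-1$, and ($C'=C+1$, or $C'>C+1$, $K_1=K_2$, $3K_2=2\delta-1$); or (III) $C>2\delta+K_1$, $K_1+2K_2\ge2\delta-1$, $3K_2\ge2\delta$, if $K_1+2K_2=2\delta-1$ then $C\ge2\delta+K_1+2$, and if $C'>C+1$ then $C\ge 2\delta+K_2$. A partial automorphism of $\mathbf A$ is an isomorphism between two substructures of $\mathbf A$. A triple $(f,g,h)$ of partial bijections is coherent if $\mathrm{Dom}(f)=\mathrm{Dom}(h)$, $\mathrm{Range}(f)=\mathrm{Dom}(g)$, $\mathrm{Range}(g)=\mathrm{Range}(h)$ and $h=g\circ f$; a map $\varphi$ between families of partial bijections is coherent if it sends coherent triples to coherent triples. A class $\mathcal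 K$ has coherent EPPA if for every $\mathbf A\in\mathcal K$ there is $\mathbf B\in\mathcal K$ containing $\mathbf A$ as a substructure such that every partial automorphism $f$ of $\mathbf A$ extends to an automorphism $\hat f$ of $\mathbf B$ and the map $f\mapsto\hat f$ is coherent. *)

(* Defs.v *)
From HB Require Import structures.
From mathcomp Require Import all_boot all_fingroup.

Set Implicit Arguments.
Unset Strict Implicit.
Unset Printing Implicit Defensive.

Record finMetric := FinMetric {
  point :> finType;
  dist : point -> point -> nat;
  dist_eq0 : forall x y, dist x y = 0 <-> x = y;
  dist_sym : forall x y, dist x y = dist y x;
  dist_triangle : forall x y z, dist x z <= dist x y + dist y z
}.

Arguments dist {f} x y.

Definition triangle_ok (K1 K2 C0 C1 a b c : nat) : Prop :=
  let p := a + b + c in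
  let m := minn a (minn b c) in
  (odd p -> [/\ 2 * K1 < p, p < 2 * K2 + 2 * m & p < C1]) /\
  (~~ odd p -> p < C0).

Definition class_A (delta K1 K2 C0 C1 : nat) (A : finMetric) : Prop :=
  (forall x y : A, x <> y -> 1 <= dist x y <= delta) /\
  (forall x y z : A, x <> y -> y <> z -> x <> z ->
     triangle_ok K1 K2 C0 C1 (dist x y) (dist y z) (dist x z)).

Definition case_II (delta K1 K2 C0 C1 : nat) : Prop :=
  let C := minn C0 C1 in
  let C' := maxn C0 C1 in
  [/\ C <= 2 * delta + K1,
      C = 2 * K1 + 2 * K2 + 1,
      K1 + K2 >= delta,
      K1 + 2 * K2 <= 2 * delta - 1 &
      C' = C + 1 \/ [/\ C' > C + 1, K1 = K2 & 3 * K2 = 2 * delta - 1]].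

Definition case_III (delta K1 K2 C0 C1 : nat) : Prop :=
  let C := minn C0 C1 in
  let C' := maxn C0 C1 in
  [/\ C > 2 * delta + K1,
      K1 + 2 * K2 >= 2 * delta - 1,
      3 * K2 >= 2 * delta,
      K1 + 2 * K2 = 2 * delta - 1 -> C >= 2 * delta + K1 + 2 &
      C' > C + 1 -> C >= 2 * delta + K2].

(* The diameter delta is a natural number, so delta < oo is built in. *)
Definition primitive_admissible (delta K1 K2 C0 C1 : nat) : Prop :=
  [/\ 3 <= delta,
      [/\ 1 <= K1, K1 <= K2 & K2 <= 2 * delta],
      [/\ 2 * delta < C0 <= 3 * delta + 2, 2 * delta < C1 <= 3 * delta + 2,
          ~~ odd C0 & odd C1],
      2 * delta + 2 <= C0 /\ 2 * delta + 2 <= C1 &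
      case_II delta K1 K2 C0 C1 \/ case_III delta K1 K2 C0 C1].

(* Partial maps of a finite type into itself; None means undefined. *)
Definition pfun (T : finType) := {ffun T -> option T}.

Definition pdom (T : finType) (f : pfun T) : {set T} :=
  [set x | f x != None].

Definition prange (T : finType) (f : pfun T) : {set T} :=
  [set y | [exists x, f x == Some y]].

Definition pcomp (T : finType) (g f : pfun T) : pfun T :=
  [ffun x => obind g (f x)].

Definition total_pfun (T : finType) (s : {perm T}) : pfun T :=
  [ffun x => Some (s x)].

Definition partial_bijection (T : finType) (f : pfun T) : Prop :=
  forall x y z, f x = Some z -> f y = Some z -> x = y.

Definition coherent_triple (T : finType) (f g h : pfun T) : Prop :=
  [/\ pdom f = pdom h, prange f = pdom g, prange g = prange h &
      h = pcomp g f].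

(* Coherence of the restriction of phi to the family P. *)
Definition coherent_map (T U : finType) (P : pfun T -> Prop)
    (phi : pfun T -> pfun U) : Prop :=
  forall f g h, P f -> P g -> P h ->
    coherent_triple f g h -> coherent_triple (phi f) (phi g) (phi h).

(* Substructures of a metric space are its subsets with the induced metric, so
   an isomorphism between two of them is a distance-preserving partial
   bijection. *)
Definition partial_automorphism (A : finMetric) (f : pfun A) : Prop :=
  partial_bijection f /\
  (forall x y x' y', f x = Some x' -> f y = Some y' ->
     dist x' y' = dist x y).

Definition automorphism (B : finMetric) (s : {perm B}) : Prop :=
  forall x y, dist (s x) (s y) = dist x y.

Definition embedding (A B : finMetric) (e : A -> B) : Prop :=
  injective e /\ (forall x y, dist (e x) (e y) = dist x y).

Definition extends (A B : finMetric) (e : A -> B) (f : pfun A)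
    (s : {perm B}) : Prop :=
  forall x x', f x = Some x' -> s (e x) = e x'.

(* "B contains A" is rendered by an embedding e of A into B. Values of phi
   outside partial automorphisms of A are irrelevant. *)
Definition coherent_EPPA (K : finMetric -> Prop) : Prop :=
  forall A : finMetric, K A ->
  exists (B : finMetric) (e : A -> B) (phi : pfun A -> {perm B}),
    [/\ K B,
        embedding e,
        forall f, partial_automorphism f ->
          automorphism (phi f) /\ extends e f (phi f) &
        coherent_map (@partial_automorphism A)
          (fun f => total_pfun (phi f))].

(* Main.v *)
Require Import Defs.
From mathcomp Require Import all_boot all_fingroup zify.

Set Implicit Arguments.
Unset Strict Implicit.
Unset Printing Implicit Defensive.

(** Fix a magic distance M, one for which every triangle (M, M, a) is allowed.  A pair of
    points joined by a path with labels a, b is given the distance op a b: the value closest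
    to M among the third sides allowed by the triangle inequality and by the bound C.
    Iterating op along walks of a partially labelled graph, and using M for the pairs about
    which no walk says anything, completes the graph to a member of the class, provided every
    short closed walk is good, i.e. bounds a disc triangulated by allowed triangles.  Only
    short walks matter because op moves values strictly towards M.  Goodness does not depend
    on how the disc is triangulated, because the class has amalgamation over two points
    (lemma flip).

    A finite edge-labelled EPPA-witness of A all of whose short closed walks are good is
    obtained from the complete graph on A with all labels on all edges by repeatedly taking
    Z/2-covers: a bad closed walk U of minimal length meets A in at most the two ends of one
    edge, so a cover in which U does not lift to a closed walk still contains A, and each
    partial automorphism of A determines a lift of the automorphism extending it. *)

(** * Allowed triangles and magic distances *)

Lemma evenE n : ~~ odd n -> exists k, n = k + k.
Proof. by move=> h; exists n./2; rewrite addnn even_halfK. Qed.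

Lemma oddE n : odd n -> exists k, n = k + k + 1.
Proof. by move=> h; exists n./2; rewrite addnn addn1 odd_halfK // prednK //; case: n h. Qed.

Section Arith.
Variables delta K1 K2 C0 C1 M : nat.

(* The admissible parameters in case (II) with C' > C + 1, see [exceptionalE]. *)
Definition exceptional : bool := (C1.+1 < C0) && (C1 <= 2 * delta + K1).

Definition regular_II : Prop :=
  [/\ C1 = 2 * K1 + 2 * K2 + 1, C0 = C1.+1, C1 <= 2 * delta + K1,
      delta <= K1 + K2 & K1 + 2 * K2 < 2 * delta].

Definition exceptional_II : Prop :=
  [/\ C1 = 4 * K1 + 1, K2 = K1, M = K1, 2 * delta = 3 * K1 + 1 & C1.+1 < C0].

(** In the last alternative 2 delta + M < C, where C is the smaller of [C0] and [C1], so the bound C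
    never pushes a value of [op] below M. *)
Definition magic_III : Prop :=
  [/\ 2 * delta + K1 < minn C0 C1, 2 * delta <= K1 + 2 * K2 + 1,
      2 * delta <= 3 * K2,
      K1 + 2 * K2 + 1 = 2 * delta ->
        2 * delta + K1 + 2 <= minn C0 C1 /\ K1 < M &
      [\/ C0 = C1.+1, C1 = C0.+1 | 2 * delta + M < minn C0 C1 /\ 2 * delta + K2 <= minn C0 C1]].

(** The first three groups of bounds make every triangle (M, M, a) with 1 <= a <= delta allowed; the
    last conjunct keeps the relations between the parameters that depend on the case. *)
Definition magic : Prop :=
  [/\ 3 <= delta, [/\ 1 <= K1, K1 <= M, M <= K2 & M <= delta],
      [/\ delta <= 2 * M, 2 * M + delta < minn C0 C1 & 2 * delta + 2 <= minn C0 C1],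
      (odd C1 /\ ~~ odd C0) &
      [\/ regular_II, exceptional_II | magic_III]].

(* A side 0 stands for two equal points: it forces the other two sides to be equal. *)
Definition tri (a b c : nat) : bool :=
  [&& [&& a <= delta, b <= delta & c <= delta],
      [&& a <= b + c, b <= a + c & c <= a + b],
      odd (a + b + c) ==>
        [&& 2 * K1 < a + b + c, a + b + c < 2 * K2 + 2 * a,
            a + b + c < 2 * K2 + 2 * b, a + b + c < 2 * K2 + 2 * c
          & a + b + c < C1]
    & ~~ odd (a + b + c) ==> (a + b + c < C0)].

Definition op (a b : nat) : nat :=
  let D := maxn (a - b) (b - a) in
  let S := minn (a + b) (minn C0 C1 - 1 - a - b) in
  if M < D then D else if S < M then S else M.

(* What the actual distance x' of two points satisfies if x has been computed for them
   with op.  In the exceptional case two sides delta leave both M - 1 and the even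
   distances above M possible, hence the weaker information for M - 1. *)
Definition approx (x' x : nat) : Prop :=
  x <> M ->
  [/\ x < M -> x' <= x \/ (exceptional /\ x.+1 = M),
      M < x -> x <= x',
      M < x -> K2 <= x -> ~~ odd (x' + x) &
      x < M -> x < K1 \/ (x = K1 /\ 2 * delta + K1 + 1 < minn C0 C1) -> ~~ odd (x' + x)].

Lemma approx_refl x : approx x x.
Proof. by move=> _; rewrite addnn odd_double; split=> // _; left. Qed.

Variant op_spec (a b : nat) : nat -> Prop :=
| OpL of M + b < a : op_spec a b (a - b)
| OpR of M + a < b : op_spec a b (b - a)
| OpS of a + b < M : op_spec a b (a + b)
| OpC of M <= a + b & minn C0 C1 <= a + b + M : op_spec a b (minn C0 C1 - 1 - a - b)
| OpM of a <= M + b & b <= M + a & M <= a + b & a + b + M < minn C0 C1 : op_spec a b M.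

Hypothesis magicM : magic.

Lemma opP a b : a <= delta -> b <= delta -> op_spec a b (op a b).
Proof.
case: magicM => d3 [K1p K1M MK2 Md] [dM MC dC] _ _ ad bd.
rewrite /op /=; case: ifP => h.
  case: (leqP b a) => ba.
    have -> : maxn (a - b) (b - a) = a - b by lia.
    constructor; lia.
  have -> : maxn (a - b) (b - a) = b - a by lia.
  constructor; lia.
case: ifP => h2; last by constructor; lia.
case: (ltnP (a + b) M) => h3.
  have -> : minn (a + b) (minn C0 C1 - 1 - a - b) = a + b by lia.
  by constructor.
have -> : minn (a + b) (minn C0 C1 - 1 - a - b) = minn C0 C1 - 1 - a - b by lia.
constructor; lia.
Qed.

Lemma opC a b : op a b = op b a.
Proof. by rewrite /op (addnC a) (maxnC (a - b)) -!subnDA (addnC a b). Qed.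

(** Parities become explicit halves of the perimeter, so that linear arithmetic can settle the case
    analyses. *)
Lemma tri_elim a b c : tri a b c ->
  [/\ [/\ a <= delta, b <= delta & c <= delta],
      [/\ a <= b + c, b <= a + c & c <= a + b] &
      (exists2 k, a + b + c = k + k & a + b + c < C0) \/
      (exists2 k, a + b + c = k + k + 1 &
        [/\ 2 * K1 < a + b + c, a + b + c < 2 * K2 + 2 * a,
            a + b + c < 2 * K2 + 2 * b, a + b + c < 2 * K2 + 2 * c
          & a + b + c < C1])].
Proof.
case/and4P=> /and3P bd /and3P mt od ev; split=> //.
case: (boolP (odd (a + b + c))) od ev => [o /and5P h _|o _ h].
  by right; case: (oddE o) => k e; exists k.
by left; case: (evenE o) => k e; exists k.
Qed.

Lemma tri_intro a b c :
  [/\ a <= delta, b <= delta & c <= delta] ->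
  [/\ a <= b + c, b <= a + c & c <= a + b] ->
  (forall k, a + b + c = k + k -> a + b + c < C0) ->
  (forall k, a + b + c = k + k + 1 ->
        [/\ 2 * K1 < a + b + c, a + b + c < 2 * K2 + 2 * a,
            a + b + c < 2 * K2 + 2 * b, a + b + c < 2 * K2 + 2 * c
          & a + b + c < C1]) -> tri a b c.
Proof.
move=> /and3P h1 /and3P h2 h3 h4; apply/and4P; split=> //.
  by apply/implyP=> /oddE[k /h4 /and5P].
by apply/implyP=> /evenE[k /h3].
Qed.

Lemma triCl a b c : tri a b c = tri b a c.
Proof.
suff h x y z : tri x y z -> tri y x z by apply/idP/idP; apply: h.
case/tri_elim=> -[? ? ?] [? ? ?] [[k e ?]|[k e [? ? ? ? ?]]].
  by apply: tri_intro => [||? ?|? ?]; try split; lia.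
by apply: tri_intro => [||? ?|? ?]; try split; lia.
Qed.

Lemma triCr a b c : tri a b c = tri a c b.
Proof.
suff h x y z : tri x y z -> tri x z y by apply/idP/idP; apply: h.
case/tri_elim=> -[? ? ?] [? ? ?] [[k e ?]|[k e [? ? ? ? ?]]].
  by apply: tri_intro => [||? ?|? ?]; try split; lia.
by apply: tri_intro => [||? ?|? ?]; try split; lia.
Qed.

Lemma tri_rot a b c : tri a b c = tri b c a.
Proof. by rewrite triCl triCr. Qed.

Lemma tri_rev a b c : tri a b c = tri c b a.
Proof. by rewrite tri_rot triCl. Qed.

Lemma tri0 b c : tri 0 b c = (b <= delta) && (b == c).
Proof.
case: magicM => d3 _ [dM MC dC] _ _.
rewrite /tri; apply/idP/idP; lia.
Qed.

(** The bound is the triangle inequality. When x' must keep its parity, a' and b' keep theirs, so a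
    failure would give an odd perimeter, against the bound 2 K2 + 2 b'. *)
Lemma approx_diff x' a' b' a b : a <= delta -> b <= delta -> M + b < a ->
  tri x' a' b' -> approx a' a -> approx b' b -> approx x' (a - b).
Proof.
case: magicM => d3 [K1p K1M MK2 Md] [dM MC dC] _ cases ad bd lt.
case/tri_elim=> _ [m1 m2 m3] par qa qb _.
have aM : a <> M by lia.
have bM : b <> M by lia.
have bltM : b < M by lia.
have Mlta : M < a by lia.
case: (qa aM) => _ /(_ Mlta) qa1 /(_ Mlta) qa2 _.
case: (qb bM) => /(_ bltM) qb1 _ _ /(_ bltM) qb2.
(* In the exceptional case b = M - 1 would force a >= 2 M, which exceeds delta. *)
have {}qb1 : b' <= b.
  case: qb1 => // -[/andP[e1 e2] e3].
  case: cases => [[]|[]|[]]; lia.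
have xb : a - b <= x' by lia.
split=> //; [lia| |lia].
move=> _ K2x; apply/negP=> /oddE[k ek].
have /evenE[k' ek'] : ~~ odd (b' + b).
  apply: qb2 => //; case: cases => [[]|[]|[]]; lia.
have /evenE[k2 ek2] : ~~ odd (a' + a) by apply: qa2; lia.
clear cases; case: par => [[k3 e3 h3]|[k3 e3 [h1 h2 h3 h4 h5]]]; lia.
Qed.

(** The perimeter is at most 2 (a + b). For a + b <= K1 it therefore cannot be odd, which gives the
    parity. *)
Lemma approx_sum x' a' b' a b : 0 < a -> 0 < b -> a + b < M ->
  tri x' a' b' -> approx a' a -> approx b' b -> approx x' (a + b).
Proof.
case: magicM => d3 [K1p K1M MK2 Md] [dM MC dC] _ _ a0 b0 lt.
case/tri_elim=> _ [m1 m2 m3] par qa qb _.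
have aM : a < M by lia.
have bM : b < M by lia.
case: (qa ltac:(lia)) => /(_ aM) qa1 _ _ /(_ aM) qa2.
case: (qb ltac:(lia)) => /(_ bM) qb1 _ _ /(_ bM) qb2.
have {}qa1 : a' <= a by case: qa1 => // -[_]; lia.
have {}qb1 : b' <= b by case: qb1 => // -[_]; lia.
have le : x' <= a + b by lia.
split=> [_|||_ h]; [by left|lia|lia|].
have /evenE[k oa] : ~~ odd (a' + a) by apply: qa2; lia.
have /evenE[k' ob] : ~~ odd (b' + b) by apply: qb2; lia.
apply/negP=> /oddE[k'' ex].
case: par => [[k3 e3 h3]|[k3 e3 [h1 h2 h3 h4 h5]]]; lia.
Qed.

(** If [C0] and [C1] are adjacent, the two perimeter bounds together say that the perimeter is below
    C. In the exceptional case the premises force a = b = delta and the value M - 1, about which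
    [approx] claims less. *)
Lemma approx_C x' a' b' a b : a <= delta -> b <= delta ->
  M <= a + b -> minn C0 C1 <= a + b + M ->
  tri x' a' b' -> approx a' a -> approx b' b -> approx x' (minn C0 C1 - 1 - a - b).
Proof.
case: magicM => d3 [K1p K1M MK2 Md] [dM MC dC] [odC evC] cases ad bd lt1 lt.
case/tri_elim=> _ [m1 m2 m3] par qa qb _.
have aM : M < a by lia.
have bM : M < b by lia.
case: (qa ltac:(lia)) => _ /(_ aM) qa1 /(_ aM) qa2 _.
case: (qb ltac:(lia)) => _ /(_ bM) qb1 /(_ bM) qb2 _.
case/oddE: odC => c1 ec1; case/evenE: evC => c0 ec0.
split=> [_|||_ h]; [|lia|lia|].
- rewrite /exceptional.
  case: cases => [[]|[]|[_ _ _ _ []]];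
  case: par => [[k3 e3 h3]|[k3 e3 [h1 h2 h3 h4 h5]]]; lia.
- apply/negP=> /oddE[k ek].
  case: cases => [[]|[]|[? ? ? ? _]]; last by lia.
  + move=> *.
    have /evenE[k1 ek1] : ~~ odd (a' + a) by apply: qa2; lia.
    have /evenE[k2 ek2] : ~~ odd (b' + b) by apply: qb2; lia.
    case: par => [[k3 e3 h3]|[k3 e3 [h1 h2 h3 h4 h5]]]; lia.
  + move=> *.
    have /evenE[k1 ek1] : ~~ odd (a' + a) by apply: qa2; lia.
    have /evenE[k2 ek2] : ~~ odd (b' + b) by apply: qb2; lia.
    case: par => [[k3 e3 h3]|[k3 e3 [h1 h2 h3 h4 h5]]]; lia.
Qed.

Lemma approx_op x' a' b' a b : 0 < a <= delta -> 0 < b <= delta ->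
  tri x' a' b' -> approx a' a -> approx b' b -> approx x' (op a b).
Proof.
move=> /andP[a0 ad] /andP[b0 bd] t qa qb.
case: opP => // h; first exact: approx_diff t qa qb.
- by rewrite triCr in t; exact: approx_diff t qb qa.
- exact: approx_sum t qa qb.
- by move=> h2; exact: approx_C t qa qb.
Qed.

(* Among several computed values for a pair the one of least rank prevails. In the
   exceptional case this makes M - 1 yield to any value above M. *)
Definition rank (x : nat) : nat :=
  if x == M then (2 * delta).+1 else if x < M then 2 * x - 1 else 2 * (delta - x).

(** What a computed value y says about the value x chosen for the same pair: an upper bound if y <
    M, a lower bound if y > M, nothing if y = M. *)
Definition below (x y : nat) : Prop :=
  (y < M -> x <= y \/ [/\ exceptional : Prop, y.+1 = M & M < x]) /\ (M < y -> y <= x).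

Definition realizable (x y z : nat) : Prop :=
  exists x' y' z', [/\ tri x' y' z', approx x' x, approx y' y & approx z' z].

Lemma approx_lt x' x : x < M -> approx x' x ->
  (x' <= x \/ exceptional /\ x.+1 = M) /\ (x < K1 -> exists k, x' + x = k + k).
Proof.
move=> xM /(_ ltac:(lia)) [/(_ xM) h1 _ _ /(_ xM) h2]; split=> // xK.
by apply: evenE; apply: h2; left.
Qed.

Lemma approx_gt x' x : M < x -> approx x' x ->
  x <= x' /\ (K2 <= x -> exists k, x' + x = k + k).
Proof.
move=> xM /(_ ltac:(lia)) [_ /(_ xM) h1 /(_ xM) h2 _]; split=> // xK.
by apply: evenE; apply: h2.
Qed.

Lemma exceptionalE : exceptional -> exceptional_II.
Proof.
case: magicM => _ _ _ _ cases /andP[h1 h2].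
by case: cases => // -[]; lia.
Qed.

(** If x > y + z, the [below] hypotheses leave only y, z < M < x with x at most y + M and z + M.
    Then a realizing triangle has a longer or equal side x' and, outside the exceptional case,
    shorter or equal y' and z'; in that case the preserved parities make up for the weaker
    information about M - 1. *)
Lemma triangle_metric x y z :
  0 < x <= delta -> 0 < y <= delta -> 0 < z <= delta ->
  below x (op y z) -> below y (op x z) -> below z (op x y) ->
  (x <> M -> y <> M -> z <> M -> realizable x y z) -> x <= y + z.
Proof.
case: magicM => d3 [K1p K1M MK2 Md] [dM MC dC] _ _.
move=> /andP[x0 xd] /andP[y0 yd] /andP[z0 zd] lx ly lz real.
rewrite leqNgt; apply/negP=> lt.
case: (leqP x M) => xM.
  have e : op y z = y + z by case: opP; lia.
  by case: lx; rewrite e => /(_ ltac:(lia)) [|[]]; lia.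
have yM : y < M.
  rewrite ltnNge; apply/negP=> My.
  have e : op x z = x - z by case: opP; lia.
  by case: ly; rewrite e => _ /(_ ltac:(lia)); lia.
have zM : z < M.
  rewrite ltnNge; apply/negP=> My.
  have e : op x y = x - y by case: opP; lia.
  by case: lz; rewrite e => _ /(_ ltac:(lia)); lia.
have xzM : x <= z + M.
  rewrite leqNgt; apply/negP=> h.
  have e : op x z = x - z by case: opP; lia.
  by case: ly; rewrite e => _ /(_ ltac:(lia)); lia.
have xyM : x <= y + M.
  rewrite leqNgt; apply/negP=> h.
  have e : op x y = x - y by case: opP; lia.
  by case: lz; rewrite e => _ /(_ ltac:(lia)); lia.
clear lx ly lz.
case: (real ltac:(lia) ltac:(lia) ltac:(lia)) => x' [y' [z' [t ax ay az]]].
case: (tri_elim t) => _ [m1 m2 m3] par.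
case: (approx_gt xM ax) => hx px.
case: (approx_lt yM ay) => hy py.
case: (approx_lt zM az) => hz pz.
case: (boolP exceptional) hy hz => [exc hy hz|_]; last by case=> [|[]] ? //; case=> [|[]] ? //; lia.
case: (exceptionalE exc) => e1 e2 e3 e4 e5.
case: (px ltac:(lia)) (py ltac:(lia)) (pz ltac:(lia)) => k ek [k' ek'] [k'' ek''].
clear px py pz real exc.
have {}hy : y' <= y \/ y.+1 = M by case: hy => [|[]]; tauto.
have {}hz : z' <= z \/ z.+1 = M by case: hz => [|[]]; tauto.
case: par => [[k3 e h3]|[k3 e [h1 h2 h3 h4 h5]]]; lia.
Qed.

Lemma triangle_small x y z :
  0 < x <= delta -> 0 < y <= delta -> 0 < z <= delta -> z <= M ->
  below z (op x y) -> x + y + z < minn C0 C1.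
Proof.
case: magicM => d3 [K1p K1M MK2 Md] [dM MC dC] _ _.
move=> /andP[x0 xd] /andP[y0 yd] /andP[z0 zd] zM lz.
rewrite ltnNge; apply/negP=> ge.
have e : op x y = minn C0 C1 - 1 - x - y by case: opP; lia.
by case: lz; rewrite e => /(_ ltac:(lia)) [|[]]; lia.
Qed.

(** A side at most M brings the perimeter below C through its own [below] hypothesis. Three sides
    above M are bounded by those of a realizing triangle. *)
Lemma triangle_C x y z :
  0 < x <= delta -> 0 < y <= delta -> 0 < z <= delta ->
  below x (op y z) -> below y (op x z) -> below z (op x y) ->
  (x <> M -> y <> M -> z <> M -> realizable x y z) ->
  (forall k, x + y + z = k + k -> x + y + z < C0) /\
  (forall k, x + y + z = k + k + 1 -> x + y + z < C1).
Proof.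
case: magicM => d3 [K1p K1M MK2 Md] [dM MC dC] [odC evC] cases.
move=> xd yd zd lx ly lz real.
have small : x + y + z < minn C0 C1 ->
  (forall k, x + y + z = k + k -> x + y + z < C0) /\
  (forall k, x + y + z = k + k + 1 -> x + y + z < C1) by move=> h; split=> k _; lia.
case: (leqP z M) => zM; first by apply: small; apply: triangle_small.
case: (leqP y M) => yM.
  by apply: small; have := triangle_small xd zd yd yM ly; lia.
case: (leqP x M) => xM.
  by apply: small; have := triangle_small yd zd xd xM lx; lia.
case: (leqP (minn C0 C1) (x + y + z)) => [ge|]; last exact: small.
clear small lx ly lz.
case: (real ltac:(lia) ltac:(lia) ltac:(lia)) => x' [y' [z' [t ax ay az]]].
case: (tri_elim t) => _ _ par.
case: (approx_gt xM ax) => hx px.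
case: (approx_gt yM ay) => hy py.
case: (approx_gt zM az) => hz pz.
case/oddE: odC => c1 ec1; case/evenE: evC => c0 ec0.
clear real t ax ay az.
(* For adjacent [C0] and [C1] the realizing perimeter is below C, yet at least x + y + z. *)
have close : C0 <= C1.+1 -> C1 <= C0.+1 -> False.
  by case: par => [[k3 e h3]|[k3 e [h1 h2 h3 h4 h5]]]; lia.
(* Sides from K2 on keep their parities, so the realizing triangle obeys the same one of the two
   bounds. *)
have far : K2 <= x -> K2 <= y -> K2 <= z ->
  (forall k, x + y + z = k + k -> x + y + z < C0) /\
  (forall k, x + y + z = k + k + 1 -> x + y + z < C1).
  move=> /px[k ek] /py[k' ek'] /pz[k'' ek''].
  by case: par => [[k3 e h3]|[k3 e [h1 h2 h3 h4 h5]]]; split=> ? ?; lia.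
case: cases => [[]|[]|[_ _ _ _ []]].
- by move=> *; case: close; lia.
- by move=> *; apply: far; lia.
- by move=> *; case: close; lia.
- by move=> *; case: close; lia.
- by case=> *; apply: far; lia.
Qed.

(** An odd perimeter below 2 K1 makes all sides smaller than K1, so a realizing triangle has sides
    of the same parities and, outside the exceptional case, no larger: it would violate the bound
    too. *)
Lemma triangle_K1 x y z k :
  0 < x <= delta -> 0 < y <= delta -> 0 < z <= delta ->
  x <= y + z -> y <= x + z -> z <= x + y ->
  (x <> M -> y <> M -> z <> M -> realizable x y z) ->
  x + y + z = k + k + 1 -> 2 * K1 < x + y + z.
Proof.
case: magicM => d3 [K1p K1M MK2 Md] [dM MC dC] _ _.
move=> xd yd zd mx my mz real e; rewrite ltnNge; apply/negP=> le.
have xM : x < M by lia.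
have yM : y < M by lia.
have zM : z < M by lia.
case: (real ltac:(lia) ltac:(lia) ltac:(lia)) => x' [y' [z' [t ax ay az]]].
case: (tri_elim t) => _ [m1 m2 m3] par.
case: (approx_lt xM ax) => hx /(_ ltac:(lia)) [kx ex].
case: (approx_lt yM ay) => hy /(_ ltac:(lia)) [ky ey].
case: (approx_lt zM az) => hz /(_ ltac:(lia)) [kz ez].
case: par => [[k3 e' h3]|[k3 e' [h1 h2 h3 h4 h5]]]; first lia.
case: (boolP exceptional) hx hy hz => [exc hx hy hz|_]; last first.
  by case=> [|[]] ? //; case=> [|[]] ? //; case=> [|[]] ? //; lia.
case: (exceptionalE exc) => e1 e2 e3 e4 e5.
clear real t ax ay az exc.
have {}hx : x' <= x \/ x.+1 = M by case: hx => [|[]]; tauto.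
have {}hy : y' <= y \/ y.+1 = M by case: hy => [|[]]; tauto.
have {}hz : z' <= z \/ z.+1 = M by case: hz => [|[]]; tauto.
lia.
Qed.

(** A violation forces x and y above K2 and z small enough to keep its parity. A realizing triangle
    is then odd, with x', y' no smaller and z' no larger, and violates the bound as well; in the
    exceptional case z' <= z comes from [C1]. *)
Lemma triangle_K2 x y z k :
  0 < x <= delta -> 0 < y <= delta -> 0 < z <= delta ->
  x <= y + z -> y <= x + z -> z <= x + y -> x + y + z < C1 ->
  (x <> M -> y <> M -> z <> M -> realizable x y z) ->
  x + y + z = k + k + 1 -> x + y + z < 2 * K2 + 2 * z.
Proof.
case: magicM => d3 [K1p K1M MK2 Md] [dM MC dC] _ cases.
move=> xd yd zd mx my mz pC real e; rewrite ltnNge; apply/negP=> le.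
have xM : M < x by lia.
have yM : M < y by lia.
have zM : z < M /\ (z < K1 \/ (z = K1 /\ 2 * delta + K1 + 1 < minn C0 C1)).
  by case: cases => [[]|[]|[]]; lia.
case: zM => zM zK.
case: (real ltac:(lia) ltac:(lia) ltac:(lia)) => x' [y' [z' [t ax ay az]]].
case: (tri_elim t) => _ [m1 m2 m3] par.
case: (approx_gt xM ax) => hx /(_ ltac:(lia)) [kx ex].
case: (approx_gt yM ay) => hy /(_ ltac:(lia)) [ky ey].
case: (az ltac:(lia)) => /(_ zM) hz _ _ /(_ zM zK) /evenE[kz ez].
clear real t ax ay az.
case: par => [[k3 e' h3]|[k3 e' [h1 h2 h3 h4 h5]]]; first lia.
case: hz => [|[exc ez']]; first lia.
case: (exceptionalE exc) => e1 e2 e3 e4 e5; lia.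
Qed.

Lemma realizable_rot x y z : realizable x y z -> realizable y z x.
Proof.
case=> x' [y' [z' [t ax ay az]]]; exists y', z', x'; split=> //.
by rewrite triCr triCl.
Qed.

Lemma tri_of_below x y z :
  0 < x <= delta -> 0 < y <= delta -> 0 < z <= delta ->
  below x (op y z) -> below y (op x z) -> below z (op x y) ->
  (x <> M -> y <> M -> z <> M -> realizable x y z) -> tri x y z.
Proof.
move=> xd yd zd lx ly lz real.
have real1 : y <> M -> z <> M -> x <> M -> realizable y z x.
  by move=> *; apply: realizable_rot; apply: real.
have real2 : z <> M -> x <> M -> y <> M -> realizable z x y.
  by move=> *; apply: realizable_rot; apply: real1.
have mx := triangle_metric xd yd zd lx ly lz real.
have my : y <= z + x by apply: triangle_metric => //; rewrite opC.
have mz : z <= x + y by apply: triangle_metric => //; rewrite opC.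
case: (triangle_C xd yd zd lx ly lz real) => ev od.
apply: tri_intro => [||//|k e]; [by split; lia|by split; lia|].
have lt := od _ e; split=> //.
- by apply: triangle_K1 e => //; lia.
- suff : y + z + x < 2 * K2 + 2 * x by lia.
  by apply: (@triangle_K2 y z x k) => //; lia.
- suff : z + x + y < 2 * K2 + 2 * y by lia.
  by apply: (@triangle_K2 z x y k) => //; lia.
- by apply: triangle_K2 e => //; lia.
Qed.

End Arith.

(** * Amalgamation of allowed triangles over two points *)

Section Flip.
Variables delta K1 K2 C0 C1 M : nat.
Hypothesis magicM : magic delta K1 K2 C0 C1 M.
Local Notation tri := (tri delta K1 K2 C0 C1).
Local Notation op := (op C0 C1 M).
Local Notation rank := (rank delta M).

Lemma rankP x : [\/ x = M /\ rank x = (2 * delta).+1,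
  x < M /\ rank x = 2 * x - 1 | M < x /\ rank x = 2 * (delta - x)].
Proof.
rewrite /rank; case: (ltngtP x M) => h; last by apply: Or31.
  by apply: Or32.
by apply: Or33.
Qed.

Lemma op_bounds a b : 0 < a <= delta -> 0 < b <= delta -> 0 < op a b <= delta.
Proof.
case: magicM => d3 [K1p K1M MK2 Md] [dM MC dC] _ _.
by move=> /andP[a0 ad] /andP[b0 bd]; case: (opP magicM) => //; lia.
Qed.

Lemma tri_fork a p : 0 < a <= delta -> 0 < p <= delta -> tri a p (op a p).
Proof.
move=> a0 p0; have o0 := op_bounds a0 p0.
case: magicM => d3 [K1p K1M MK2 Md] [dM MC dC] [/oddE[c1 ec1] /evenE[c0 ec0]] cases.
move: o0; case: (opP magicM); try lia; move=> *; apply: tri_intro.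
all: try (split; lia).
all: move=> k ek.
all: try (case: cases => [[]|[]|[? ? ? ? []]]; try split; lia).
Qed.

Section Core.
Variables a b c p q : nat.
Hypotheses (a0 : 0 < a <= delta) (b0 : 0 < b <= delta) (c0 : 0 < c <= delta)
  (p0 : 0 < p <= delta) (q0 : 0 < q <= delta).
Hypotheses (t1 : tri a b c) (t2 : tri b p q) (rk : rank (op a p) <= rank (op c q)).

Lemma flip_M : op a p = M -> tri (op a p) q c.
Proof.
move=> e; have := op_bounds c0 q0.
have e2 : op c q = M.
  have := op_bounds c0 q0.
  case: (rankP (op a p)) (rankP (op c q)) rk => [[? ->]|[]|[]]; try lia.
  by case=> [[]|[]|[]] ? ->; lia.
have := tri_fork c0 q0; rewrite e e2 => t _.
by rewrite tri_rev.
Qed.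

Lemma flip_diff : M + p < a -> tri (a - p) q c.
Proof.
case: magicM => d3 [K1p K1M MK2 Md] [dM MC dC] [/oddE[? ec1] /evenE[? ec0]] cases lt.
have e : op a p = a - p by case: (opP magicM); lia.
move: rk; rewrite e.
case: (rankP (a - p)) => [] [h ->]; try lia.
case: (tri_elim t1) => _ [m1 m2 m3] par1.
case: (tri_elim t2) => _ [m1' m2' m3'] par2.
move: a0 b0 c0 p0 q0; clear a0 b0 c0 p0 q0 t1 t2 rk e => a0 b0 c0 p0 q0 hr.
have [q1 q2] : q <= a - p + c /\ c <= a - p + q.
  move: hr; case: (rankP (op c q)) => [] [h2 ->]; move: h2; case: (opP magicM); lia.
have hS : M <= c + q by lia.
(* The bound C can push [op c q] below M only in the exceptional case with c = q = delta. *)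
have hC : c + q + M < minn C0 C1 \/ exceptional_II delta K1 K2 C0 C1 M /\ c + q = 2 * delta.
  case: (ltnP (c + q + M) (minn C0 C1)) => hh; [by left|right].
  case: par1 => [[k1 e1 g1]|[k1 e1 [g1 g2 g3 g4 g5]]];
  case: par2 => [[k2 e2 f1]|[k2 e2 [f1 f2 f3 f4 f5]]];
  (case: cases => [[]|exc|[? ? ? ? []]];
   [lia|by case: {+}exc => *; split=> //; lia|lia|lia|lia]).
clear hr; apply: tri_intro; [split; lia|split; lia|move=> k ek|move=> k ek].
  case: hC => [?|[[? ? ? ? ?] ?]]; last first.
    case: par1 => [[k1 e1 g1]|[k1 e1 [g1 g2 g3 g4 g5]]];
    case: par2 => [[k2 e2 f1]|[k2 e2 [f1 f2 f3 f4 f5]]]; lia.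
  case: par1 => [[k1 e1 g1]|[k1 e1 [g1 g2 g3 g4 g5]]];
  case: par2 => [[k2 e2 f1]|[k2 e2 [f1 f2 f3 f4 f5]]];
  case: cases => [[]|[]|[? ? ? ? []]]; lia.
split.
1,2,3,4,5: case: par1 => [[k1 e1 g1]|[k1 e1 [g1 g2 g3 g4 g5]]].
1,2,3,4,5,6,7,8,9,10: case: par2 => [[k2 e2 f1]|[k2 e2 [f1 f2 f3 f4 f5]]].
all: case: hC => [?|[[? ? ? ? ?] ?]]; last by lia.
all: case: cases => [[]|[]|[? ? ? ? []]].
all: lia.
Qed.

Lemma flip_sum : a + p < M -> tri (a + p) q c.
Proof.
case: magicM => d3 [K1p K1M MK2 Md] [dM MC dC] _ cases lt.
have e : op a p = a + p by case: (opP magicM); lia.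
move: rk; rewrite e.
case: (rankP (a + p)) => [] [h ->]; try lia.
case: (tri_elim t1) => _ [m1 m2 m3] par1.
case: (tri_elim t2) => _ [m1' m2' m3'] par2.
move: a0 b0 c0 p0 q0; clear a0 b0 c0 p0 q0 t1 t2 rk e => a0 b0 c0 p0 q0 hr.
have [q1 q2] : a + p <= q + c /\ a + p + q + c < minn C0 C1.
  move: hr; case: (rankP (op c q)) => [] [h2 ->]; move: h2; case: (opP magicM); lia.
clear hr; apply: tri_intro; [split; lia|split; lia|move=> k ek; lia|move=> k ek].
split; last lia.
1,2,3,4: case: par1 => [[k1 e1 g1]|[k1 e1 [g1 g2 g3 g4 g5]]].
1,2,3,4,5,6,7,8: case: par2 => [[k2 e2 f1]|[k2 e2 [f1 f2 f3 f4 f5]]].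
all: case: cases => [[]|[]|[? ? ? ? []]].
all: lia.
Qed.

Lemma flip_C : M <= a + p -> minn C0 C1 <= a + p + M ->
  tri (minn C0 C1 - 1 - a - p) q c.
Proof.
case: magicM => d3 [K1p K1M MK2 Md] [dM MC dC] [/oddE[? ec1] /evenE[? ec0]] cases lt1 lt2.
have e : op a p = minn C0 C1 - 1 - a - p by case: (opP magicM); lia.
move: rk; rewrite e.
case: (rankP (minn C0 C1 - 1 - a - p)) => [] [h ->]; try lia.
case: (tri_elim t1) => _ [m1 m2 m3] par1.
case: (tri_elim t2) => _ [m1' m2' m3'] par2.
move: a0 b0 c0 p0 q0; clear a0 b0 c0 p0 q0 t1 t2 rk e => a0 b0 c0 p0 q0 hr.
have hcq : c + q <= a + p /\ minn C0 C1 - 1 - a - p <= c + q.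
  move: hr; case: (rankP (op c q)) => [] [h2 ->]; move: h2;
  clear par1 par2 cases ec1 ec0; case: (opP magicM); lia.
have diff u v : op c q = u - v -> M < u - v -> u <= delta ->
    minn C0 C1 < a + p + (u - v) /\ minn C0 C1 - 1 - a - p <= delta - (u - v).
  move=> e hM ud; move: hr; rewrite e; clear par1 par2 cases ec1 ec0;
  case: (rankP (u - v)) => [] [h2 ->]; lia.
have [q3 q4] : q <= M + c /\ c <= M + q.
  split; rewrite leqNgt; apply/negP=> hh.
  - have [|||g1 g2] := diff q c; try lia.
      by clear par1 par2 cases diff; case: (opP magicM); lia.
    case: cases => [[]|[]|[? ? ? ? []]]; try lia;
    case: par2 => [[k2 e2 f1]|[k2 e2 [f1 f2 f3 f4 f5]]]; lia.
  - have [|||g1 g2] := diff c q; try lia.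
      by clear par1 par2 cases diff; case: (opP magicM); lia.
    case: cases => [[]|[]|[? ? ? ? []]]; try lia;
    case: par1 => [[k2 e2 f1]|[k2 e2 [f1 f2 f3 f4 f5]]]; lia.
clear hr diff magicM.
set x := minn C0 C1 - 1 - a - p in h hcq *.
have [C [hx eC CC0 CC1]] : exists C, [/\ x + a + p + 1 = C, C = minn C0 C1, C <= C0 & C <= C1].
  by exists (minn C0 C1); rewrite /x; split; lia.
clearbody x; rewrite -eC in MC dC lt2.
(* The premise C <= a + p + M excludes the alternative 2 delta + M < C, so outside the exceptional
   case [C0] and [C1] are at most C + 1. *)
have {}cases : exceptional_II delta K1 K2 C0 C1 M \/ [/\ C0 <= C.+1, C1 <= C.+1 &
    regular_II delta K1 K2 C0 C1 \/ [/\ 2 * delta + K1 < C, 2 * delta <= K1 + 2 * K2 + 1,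
      2 * delta <= 3 * K2 & K1 + 2 * K2 + 1 = 2 * delta -> 2 * delta + K1 + 2 <= C /\ K1 < M]].
  case: cases => [r|r|r]; [right|by left|right].
    by case: (r) => *; split; [lia|lia|left].
  by case: r => r1 r2 r3 r4 r5; rewrite -eC in r1 r4 r5; split;
    [case: r5; lia|case: r5; lia|right; split].
have {eC} C01 : C = C0 \/ C = C1 by lia.
have [q1 q2] : q <= x + c /\ c <= x + q.
  case: cases => [[? ? ? ? ?]|[? ? _]].
    split.
      by case: par1 => [[k1 e1 g1]|[k1 e1 [g1 g2 g3 g4 g5]]];
      case: par2 => [[k2 e2 f1]|[k2 e2 [f1 f2 f3 f4 f5]]]; lia.
    by case: par1 => [[k1 e1 g1]|[k1 e1 [g1 g2 g3 g4 g5]]];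
    case: par2 => [[k2 e2 f1]|[k2 e2 [f1 f2 f3 f4 f5]]]; lia.
  split.
    by case: par2 => [[k2 e2 f1]|[k2 e2 [f1 f2 f3 f4 f5]]]; lia.
  by case: par1 => [[k2 e2 f1]|[k2 e2 [f1 f2 f3 f4 f5]]]; lia.
apply: tri_intro; [split; lia|split; lia|move=> k ek; lia|move=> k ek].
split; last lia.
1,2,3,4: case: par1 => [[k1 e1 g1]|[k1 e1 [g1 g2 g3 g4 g5]]].
1,2,3,4,5,6,7,8: case: par2 => [[k2 e2 f1]|[k2 e2 [f1 f2 f3 f4 f5]]].
all: case: cases => [[? ? ? ? ?]|[? ? [[? ? ? ? ?]|[? ? ? ?]]]].
all: lia.
Qed.

End Core.

Lemma flip_core a b c p q :
  0 < a <= delta -> 0 < b <= delta -> 0 < c <= delta ->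
  0 < p <= delta -> 0 < q <= delta -> tri a b c -> tri b p q ->
  rank (op a p) <= rank (op c q) -> tri (op a p) q c.
Proof.
move=> a0 b0 c0 p0 q0 t1 t2 rk.
have [/eqP e|ne] := boolP (op a p == M); first exact: (flip_M a0 b0 c0 p0 q0 t1 t2 rk e).
have hx := opP magicM (proj2 (andP a0)) (proj2 (andP p0)).
case: hx ne => [h|h|h|h1 h2|_ _ _ _] ne; last by rewrite eqxx in ne.
- exact: (@flip_diff a b c p q).
- rewrite triCr; apply: (@flip_diff p b q a c) => //.
  + by rewrite triCl.
  + by rewrite triCl.
  + by rewrite opC (opC _ _ _ q).
- exact: (@flip_sum a b c p q).
- exact: (@flip_C a b c p q).
Qed.

Lemma tri_le a b c : tri a b c -> [/\ a <= delta, b <= delta & c <= delta].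
Proof. by case/tri_elim. Qed.

(** Here b and d are the diagonals of a quadrilateral. The pairs a, p and c, q each propose a value
    for d by [op], and the one of smaller rank suits both. A zero side identifies two points and is
    treated first. *)
Lemma flip a b c p q : tri a b c -> tri b p q -> exists2 d, tri a p d & tri d q c.
Proof.
move=> t1 t2.
have [ad bd cd] := tri_le t1; have [_ pd qd] := tri_le t2.
case: (posnP a) => [a0|a0].
  move: t1; rewrite a0 (tri0 magicM) => /andP[_ /eqP <-].
  by exists p; [rewrite (tri0 magicM) pd eqxx|rewrite -tri_rot].
case: (posnP p) => [p0|p0].
  move: t2; rewrite p0 triCl (tri0 magicM) => /andP[_ /eqP <-].
  by exists a; [rewrite triCl (tri0 magicM) ad eqxx|].
case: (posnP c) => [c0|c0].
  move: t1; rewrite c0 tri_rev (tri0 magicM) => /andP[_ /eqP e].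
  by exists q; [rewrite -e|rewrite tri_rev (tri0 magicM) qd eqxx].
case: (posnP q) => [q0|q0].
  move: t2; rewrite q0 tri_rev (tri0 magicM) => /andP[_ /eqP e].
  by exists c; [rewrite e|rewrite triCl (tri0 magicM) cd eqxx].
have [a1 c1 p1 q1] : [/\ 0 < a <= delta, 0 < c <= delta, 0 < p <= delta & 0 < q <= delta].
  by rewrite a0 c0 p0 q0.
case: (posnP b) => [b0|b0].
  move: t1 t2; rewrite b0 triCl !(tri0 magicM) => /andP[_ /eqP <-] /andP[_ /eqP <-].
  exists (op a p); first exact: tri_fork.
  by rewrite tri_rev; apply: tri_fork.
have b1 : 0 < b <= delta by rewrite b0.
case: (leqP (rank (op a p)) (rank (op c q))) => rk.
  by exists (op a p); [exact: tri_fork|apply: flip_core t1 t2 rk].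
exists (op c q); last by rewrite tri_rev; apply: tri_fork.
rewrite tri_rev; apply: (@flip_core c b a q p) => //; last exact: ltnW.
  by rewrite tri_rev.
by rewrite triCr.
Qed.

End Flip.

Lemma magic_exists delta K1 K2 C0 C1 : primitive_admissible delta K1 K2 C0 C1 ->
  exists M, magic delta K1 K2 C0 C1 M.
Proof.
case=> d3 [K1p K12 K2d] [C0b C1b ev od] [dC0 dC1] [] [];
  case/oddE: (od) => c1 ec1; case/evenE: (ev) => c0 ec0 => h1 h2 h3 h4 h5.
  (* The least M with K1 <= M and delta <= 2 M. *)
  exists (maxn K1 (uphalf delta)).
  split=> //; try (split; lia).
  case: h5 => [h5|[h5 h6 h7]]; [apply: Or31|apply: Or32]; split; lia.
(* The boolean summand ensures K1 < M in the boundary case, as [magic_III] demands. *)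
exists (maxn (K1 + (K1 + 2 * K2 + 1 == 2 * delta)) (uphalf delta)).
split=> //; try (split; lia).
apply: Or33; split; try lia.
case: (leqP C1 C0) => hC; case: (leqP (maxn C0 C1) (minn C0 C1 + 1)) => hC'.
- by apply: Or31; lia.
- by apply: Or33; split; lia.
- by apply: Or32; lia.
- by apply: Or33; split; lia.
Qed.

(** * Unwinding bad closed walks *)

Section Walks.
Variables (lab V : finType) (E : lab -> rel V).

Fixpoint conn (w : seq lab) (x y : V) : bool :=
  if w is a :: w' then [exists z, E a x z && conn w' z y] else x == y.

Lemma conn_cat w1 w2 x y z : conn w1 x y -> conn w2 y z -> conn (w1 ++ w2) x z.
Proof.
elim: w1 x => [|a w1 IH] x /=; first by move/eqP->.
case/existsP=> u /andP[h1 h2] h3; apply/existsP; exists u.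
by rewrite h1 (IH u).
Qed.

Lemma conn_vertices w x y : conn w x y -> exists v : nat -> V,
  [/\ v 0 = x, v (size w) = y & forall a0 i, i < size w -> E (nth a0 w i) (v i) (v i.+1)].
Proof.
elim: w x => [|a w IH] x /=; first by move/eqP=> ->; exists (fun=> y).
case/existsP=> z /andP[h1 /IH[v [v0 vn vE]]].
exists (fun i => if i is j.+1 then v j else x); split=> // a0 [|i] hi /=; first by rewrite v0.
exact: vE.
Qed.

Lemma conn_segment (a0 : lab) w (v : nat -> V) i j :
  (forall k, k < size w -> E (nth a0 w k) (v k) (v k.+1)) ->
  i <= j -> j <= size w -> conn (drop i (take j w)) (v i) (v j).
Proof.
move=> h ij; rewrite -(subnKC ij); move: (j - i) => {ij}d.
elim: d i => [|d IH] i; first by rewrite addn0 drop_oversize //= size_take_min geq_minl.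
rewrite addnS => ls; have lt : i < size w by apply: leq_trans ls; rewrite ltnS leq_addr.
rewrite (drop_nth a0) ?size_takel ?ltnS ?leq_addr //= nth_take ?ltnS ?leq_addr //.
apply/existsP; exists (v i.+1); rewrite h //= -addSn.
by apply: IH; rewrite addSn.
Qed.

End Walks.

(** * Coherent extension of partial bijections to permutations *)

Section CoherentExtension.
Variable T : finType.
Implicit Types f g h : pfun T.

(* Outside its domain f is extended by the enumeration-preserving bijection between the
   complements; this choice is what makes the extension coherent. *)
Definition fill f (x : T) : T :=
  if f x is Some y then y else nth x (enum (~: prange f)) (index x (enum (~: pdom f))).

Lemma card_prange f : partial_bijection f -> #|prange f| = #|pdom f|.
Proof.
have Some_injT : injective (@Some T) by move=> ? ? [].
move=> pf; rewrite -(card_imset _ Some_injT) -[RHS](card_in_imset (f := f)).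
  apply: eq_card => -[y|].
    apply/imsetP/imsetP=> [[z zr [->]]|[x xd e]].
      move: zr; rewrite inE => /existsP[x /eqP fx]; exists x => //.
      by rewrite inE fx.
    by exists y => //; rewrite inE; apply/existsP; exists x; rewrite e.
  apply/imsetP/imsetP=> [[z _]//|[x]].
  by rewrite inE => /negP h e; case: h; rewrite -e.
move=> x y; rewrite !inE; case fx: (f x) => [z|] // _ _ /esym fy.
exact: pf fx fy.
Qed.

Lemma size_prangeC f : partial_bijection f ->
  size (enum (~: prange f)) = size (enum (~: pdom f)).
Proof.
move=> pf; rewrite -!cardE [#|~: prange f|]cardsCs [#|~: pdom f|]cardsCs !setCK.
by rewrite card_prange.
Qed.

Lemma index_pdomC f x : partial_bijection f -> f x = None ->
  index x (enum (~: pdom f)) < size (enum (~: prange f)).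
Proof. by move=> pf fx; rewrite size_prangeC // index_mem mem_enum !inE fx. Qed.

Lemma fill_notin f x : partial_bijection f -> f x = None -> fill f x \notin prange f.
Proof.
move=> pf fx; rewrite /fill fx.
have : nth x (enum (~: prange f)) (index x (enum (~: pdom f))) \in enum (~: prange f).
  by rewrite mem_nth // index_pdomC.
by rewrite mem_enum inE.
Qed.

Lemma mem_prange f x y : f x = Some y -> y \in prange f.
Proof. by move=> fx; rewrite inE; apply/existsP; exists x; rewrite fx. Qed.

Lemma fill_inj f : partial_bijection f -> injective (fill f).
Proof.
move=> pf x y; case fx: (f x) => [a|]; case fy: (f y) => [b|].
- by rewrite /fill fx fy => ab; rewrite -ab in fy; apply: pf fx fy.
- move=> e; have := fill_notin pf fy; rewrite -e {1}/fill fx.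
  by rewrite (mem_prange fx).
- move=> e; have := fill_notin pf fx; rewrite e {1}/fill fy.
  by rewrite (mem_prange fy).
- rewrite /fill fx fy (set_nth_default x) ?index_pdomC // => /eqP.
  rewrite nth_uniq ?enum_uniq ?index_pdomC // => /eqP e.
  have hx : x \in enum (~: pdom f) by rewrite mem_enum !inE fx.
  have hy : y \in enum (~: pdom f) by rewrite mem_enum !inE fy.
  by rewrite -(nth_index x hx) e nth_index.
Qed.

(** The identity is the default value when [fill f] is not injective. *)
Definition fill_perm f : {perm T} := insubd (perm_one T) [ffun x => fill f x].

Lemma fill_permE f x : partial_bijection f -> fill_perm f x = fill f x.
Proof.
move=> pf; rewrite -pvalE /fill_perm val_insubd.
suff -> : injectiveb [ffun x0 => fill f x0] by rewrite ffunE.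
by apply/injectiveP=> y z; rewrite !ffunE => /(fill_inj pf).
Qed.

(** Off their domains f, g and h preserve the index in enumerated complements. Coherence makes these
    complements match, so the index is carried through. *)
Lemma fill_coherent f g h x : partial_bijection f -> partial_bijection g ->
  coherent_triple f g h -> fill h x = fill g (fill f x).
Proof.
move=> pf pg [dfh rfg rgh hE].
case fx: (f x) => [y|].
  have gy : y \in pdom g by rewrite -rfg (mem_prange fx).
  move: gy; rewrite inE; case gy: (g y) => [z|] // _.
  have -> : fill f x = y by rewrite /fill fx.
  by rewrite /fill hE ffunE fx /= gy.
have hx : h x = None by rewrite hE ffunE fx.
have hy := fill_notin pf fx; rewrite rfg inE negbK in hy.
have yE : fill f x = nth x (enum (~: prange f)) (index x (enum (~: pdom f))).
  by rewrite /fill fx.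
move: (fill f x) hy yE => y /eqP gy yE.
rewrite /fill hx gy -dfh -rgh -rfg {2}yE index_uniq ?enum_uniq ?index_pdomC //.
apply: set_nth_default.
by rewrite size_prangeC // -rfg index_pdomC.
Qed.

End CoherentExtension.

(** * Covers of edge-labelled witnesses that destroy bad closed walks *)

Section Unwinding.
Variables (A lab : finType) (lb : A -> A -> lab) (good : pred (seq lab)).
Hypothesis lb_sym : forall p q, lb p q = lb q p.
Hypothesis good_rot : forall w1 w2, good (w1 ++ w2) -> good (w2 ++ w1).
Hypothesis good_digon : forall a, good [:: a; a].

(** A walk from p to q is closed up by the edge from q to p. For p = q it is already closed, and
    [lb p p] has no meaning. *)
Definition arc_good (w : seq lab) (p q : A) : bool :=
  if p == q then good w else good (rcons w (lb p q)).

Hypothesis good_glue : forall w1 w2 w3 p q r,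
  arc_good w1 p q -> arc_good w2 q r -> arc_good w3 r p -> good (w1 ++ w2 ++ w3).

Definition partial_iso (f : pfun A) : Prop :=
  partial_bijection f /\
  (forall p q p' q', f p = Some p' -> f q = Some q' -> p != q -> lb p' q' = lb p q).

Record witness (V : finType) (E : lab -> rel V) (e : A -> V)
    (phi : pfun A -> {perm V}) : Prop := Witness {
  w_sym : forall a x y, E a x y = E a y x;
  w_inj : injective e;
  w_edge : forall p q, p != q -> E (lb p q) (e p) (e q);
  w_aut : forall f, partial_iso f -> forall a x y, E a (phi f x) (phi f y) = E a x y;
  w_ext : forall f, partial_iso f -> forall p p', f p = Some p' -> phi f (e p) = e p';
  w_coh : forall f g h, partial_iso f -> partial_iso g -> partial_iso h ->
    coherent_triple f g h -> forall x, phi h x = phi g (phi f x)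
}.

Definition no_bad (V : finType) (E : lab -> rel V) (n : nat) : Prop :=
  forall w x, size w <= n -> 0 < size w -> conn E w x x -> good w.

Section Step.
Variables (V : finType) (E : lab -> rel V) (e : A -> V) (phi : pfun A -> {perm V}).
Variable n : nat.
Hypothesis wit : witness E e phi.
Hypothesis nb : no_bad E n.

(* Closed walks of length n.+1, with the first vertex repeated at the end. *)
Definition cyc := (n.+2.-tuple V * n.+1.-tuple lab)%type.
Implicit Types (U : cyc) (f g h : pfun A).

Definition vtx U i : V := nth (thead U.1) U.1 i.
Definition lbl U i : lab := nth (thead U.2) U.2 i.

Definition bad U : bool :=
  [&& vtx U 0 == vtx U n.+1,
      [forall i : 'I_n.+1, E (lbl U i) (vtx U i) (vtx U i.+1)] & ~~ good U.2].

Definition act (s : {perm V}) U : cyc := (map_tuple s U.1, U.2).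

Lemma vtx_act s U i : vtx (act s U) i = s (vtx U i).
Proof.
rewrite /vtx /act /= /thead tnth_map.
by case: (ltnP i (size U.1)) => h;
  [rewrite (nth_map (tnth U.1 ord0))|rewrite !nth_default ?size_map].
Qed.

Lemma lbl_act s U i : lbl (act s U) i = lbl U i. Proof. by []. Qed.

Lemma actK s : cancel (act s) (act s^-1).
Proof.
case=> us ls; congr (_, _); apply: val_inj => /=.
by rewrite -map_comp map_id_in // => x _ /=; rewrite permK.
Qed.

Lemma actVK s : cancel (act s^-1) (act s).
Proof. by move=> U; rewrite -{1}(invgK s) actK. Qed.

Lemma act_bad f U : partial_iso f -> bad (act (phi f) U) = bad U.
Proof.
move=> pf; rewrite /bad !vtx_act (inj_eq perm_inj); congr [&& _, _ & _].
by apply: eq_forallb => i; rewrite !vtx_act lbl_act (w_aut wit).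
Qed.

Definition inU (x : V) U : bool := [exists i : 'I_n.+1, vtx U i == x].

Lemma inU_act (s : {perm V}) x U : inU (s x) (act s U) = inU x U.
Proof. by apply: eq_existsb => i; rewrite vtx_act (inj_eq perm_inj). Qed.

Definition matches U (i : nat) x a y : bool :=
  (lbl U i == a) &&
  ((vtx U i == x) && (vtx U i.+1 == y) || (vtx U i == y) && (vtx U i.+1 == x)).

Lemma bad_in U (i : 'I_n.+1) x a y : bad U -> matches U i x a y -> inU x U /\ inU y U.
Proof.
case/and3P=> /eqP cl _ _ /andP[_].
have h0 : inU (vtx U i) U by apply/existsP; exists i.
have h1 : inU (vtx U i.+1) U.
  case: (ltnP i n) => h; first by apply/existsP; exists (Ordinal (h : i.+1 < n.+1)).
  (* [inU] inspects only the positions 0 to n; the final vertex is the one at position 0 again. *)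
  have -> : i.+1 = n.+1 by have := ltn_ord i; lia.
  by apply/existsP; exists ord0; rewrite cl.
by case/orP=> /andP[/eqP <- /eqP <-].
Qed.

(* Between vertices of the embedded copy of A, the arcs of a bad walk are closed up
   by edges of A into shorter, hence good, walks. *)
Lemma bad_sorted_points U i j k p q r : bad U -> i < j < k -> k < n.+1 ->
  e p = vtx U i -> e q = vtx U j -> e r = vtx U k -> False.
Proof.
case/and3P=> /eqP cl /forallP ed /negP ng /andP[ij jk] kn ep eq_ er; apply: ng.
set w := tval U.2; have sw : size w = n.+1 by rewrite size_tuple.
have edge l : l < size w -> E (nth (thead U.2) w l) (vtx U l) (vtx U l.+1).
  by rewrite sw => h; apply: (ed (Ordinal h)).
(* Each of the three arcs omits at least two of the n + 1 edges, so with one closing edge its length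
   is at most n. *)
have arc u a b : 0 < size u -> size u < n -> conn E u (e a) (e b) -> arc_good u a b.
  rewrite /arc_good => u0 un c; case: eqP => [ab|/eqP ab].
    by apply: (nb (x := e a)); [exact: ltnW|by []|rewrite -ab in c].
  apply: (nb (x := e a)); rewrite ?size_rcons // -cats1.
  apply: (conn_cat c) => /=; apply/existsP; exists (e a).
  by rewrite eqxx lb_sym (w_edge wit) // eq_sym.
have sz l m : l <= m -> m <= size w -> size (drop l (take m w)) = m - l.
  by move=> lm ms; rewrite size_drop size_takel.
have a1 : arc_good (drop i (take j w)) p q.
  by apply: arc; rewrite ?sz ?ep ?eq_; try lia; apply: conn_segment edge _ _; lia.
have a2 : arc_good (drop j (take k w)) q r.
  by apply: arc; rewrite ?sz ?er ?eq_; try lia; apply: conn_segment edge _ _; lia.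
have a3 : arc_good (drop k w ++ take i w) r p.
  have c1 : conn E (drop k w) (e r) (vtx U 0).
    by rewrite cl er -sw -{1}(take_size w); apply: conn_segment edge _ _; lia.
  have c2 : conn E (take i w) (vtx U 0) (e p).
    by rewrite ep -(drop0 (take i w)); apply: conn_segment edge _ _; lia.
  by apply: arc (conn_cat c1 c2); rewrite size_cat size_drop size_takel; lia.
have tk l m : l <= m -> take l w ++ drop l (take m w) = take m w.
  by move=> lm; rewrite -{2}(cat_take_drop l (take m w)) take_takel.
have := good_glue a1 a2 a3; rewrite !catA => /good_rot.
by rewrite -catA catA tk 1?ltnW // catA tk 1?ltnW // cat_take_drop.
Qed.

Lemma bad_three_points U i j k p q r : bad U -> i < n.+1 -> j < n.+1 -> k < n.+1 ->
  i <> j -> j <> k -> i <> k ->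
  e p = vtx U i -> e q = vtx U j -> e r = vtx U k -> False.
Proof.
move=> b hi hj hk ij jk ik ep eq_ er.
have [h|h] : i < j \/ j < i by lia.
  have [h'|h'] : k < i \/ i < k by lia.
    by apply: (bad_sorted_points b _ _ er ep eq_); rewrite ?h' ?h.
  have [h''|h''] : k < j \/ j < k by lia.
    by apply: (bad_sorted_points b _ _ ep er eq_); rewrite ?h' ?h''.
  by apply: (bad_sorted_points b _ _ ep eq_ er); rewrite ?h ?h''.
have [h'|h'] : k < j \/ j < k by lia.
  by apply: (bad_sorted_points b _ _ er eq_ ep); rewrite ?h' ?h.
have [h''|h''] : k < i \/ i < k by lia.
  by apply: (bad_sorted_points b _ _ eq_ er ep); rewrite ?h' ?h''.
by apply: (bad_sorted_points b _ _ eq_ ep er); rewrite ?h ?h''.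
Qed.

Definition last_in_A U : bool :=
  bad U && [exists p, exists q, [&& e p == vtx U n, e q == vtx U 0, p != q & lb p q == lbl U n]].

Definition V1 := (V * {ffun cyc -> bool})%type.

(* The second component changes exactly along the last edge of U, so that a bad U does
   not lift to a closed walk. *)
Definition E1 a (u v : V1) : bool :=
  E a u.1 v.1 &&
  [forall U, bad U ==>
    [forall i : 'I_n.+1, matches U i u.1 a v.1 ==> (u.2 U (+) v.2 U == (i == n :> nat))]].

(** If the last edge of U is an edge of A, its end at [vtx U 0] goes to the other sheet, as [E1]
    demands. By [last_not_in_A] no other edge of U is then an edge of A. *)
Definition e1 p : V1 := (e p, [ffun U => (e p == vtx U 0) && last_in_A U]).

(* The correction that makes the lift of phi f map e1 p to e1 p' whenever f p = Some p'. *)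
Definition twist f U : bool :=
  [exists p, (f p != None) && (e p == vtx U 0)] &&
  (last_in_A U (+) last_in_A (act (phi f) U)).

(** The correction is the same at all vertices of U', so it cancels along the edges of U' and [E1]
    is preserved. *)
Definition lift f (u : V1) : V1 :=
  (phi f u.1, [ffun U => let U' := act (phi f)^-1 U in
                         u.2 U' (+) (inU u.1 U' && twist f U')]).

Lemma lift_act f u U : (lift f u).2 (act (phi f) U) = u.2 U (+) (inU u.1 U && twist f U).
Proof. by rewrite ffunE /= actK. Qed.

Lemma lift_inj f : injective (lift f).
Proof.
move=> [x c] [y d] eq_; have xy : x = y by case: eq_ => /perm_inj.
subst y; congr (_, _); apply/ffunP=> U.
have := lift_act f (x, c) U; rewrite eq_ lift_act /=.
by move/addIb.
Qed.

Definition phi1 f : {perm V1} := perm (@lift_inj f).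

Lemma E1_sym a u v : E1 a u v = E1 a v u.
Proof.
rewrite /E1 (w_sym wit); congr (_ && _); apply: eq_forallb => U; congr (_ ==> _).
apply: eq_forallb => i; rewrite addbC /matches orbC.
by rewrite [in X in _ = X]orbC orbC.
Qed.

(** Two edges of A in U would occupy three positions, against [bad_three_points], unless n = 1; then
    U is a digon with equal labels, hence good. *)
Lemma last_not_in_A U i p q : bad U -> i < n -> p != q ->
  e p = vtx U i -> e q = vtx U i.+1 -> lb p q = lbl U i -> last_in_A U = false.
Proof.
move=> b lt pq ep eq_ el; apply/negP=> /andP[_ /existsP[p' /existsP[q']]].
case/and4P=> /eqP ep' /eqP eq' _ /eqP el'.
case: (posnP i) => i0; last by apply: (bad_three_points b _ _ _ _ _ _ eq' ep ep'); lia.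
subst i; case: (ltnP 1 n) => n1.
  by apply: (bad_three_points b _ _ _ _ _ _ ep eq_ ep'); lia.
have n_eq : n = 1 by lia.
case/and3P: b => _ _ /negP; apply.
have -> : tval U.2 = [:: lbl U 0; lbl U n].
  apply: (@eq_from_nth _ (thead U.2)); first by rewrite size_tuple n_eq.
  rewrite size_tuple /lbl => -[|[|l]] //= h; first by congr (nth _ _ _).
  by move: h; rewrite {1}n_eq.
rewrite -el -el'; have -> : p' = q by apply: (w_inj wit); rewrite ep' n_eq eq_.
have -> : q' = p by apply: (w_inj wit); rewrite eq' ep.
by rewrite lb_sym good_digon.
Qed.

Lemma e1_edge_oriented U (i : 'I_n.+1) p q : bad U -> p != q ->
  e p = vtx U i -> e q = vtx U i.+1 -> lb p q = lbl U i ->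
  (e1 p).2 U (+) (e1 q).2 U = (i == n :> nat).
Proof.
move=> b pq ep eq_ el; rewrite !ffunE; case: (@eqP _ (nat_of_ord i) n) => [i_n|i_n].
  case/and3P: (b) => /eqP cl _ _.
  have -> : last_in_A U.
    rewrite /last_in_A b; apply/existsP; exists p; apply/existsP; exists q.
    by rewrite ep eq_ el cl i_n !eqxx pq.
  by rewrite cl -i_n -eq_ !andbT eqxx (inj_eq (w_inj wit)) (negbTE pq).
have lt : i < n by have := ltn_ord i; lia.
by rewrite (last_not_in_A b lt pq ep eq_ el) !andbF.
Qed.

Lemma e1_edge p q : p != q -> E1 (lb p q) (e1 p) (e1 q).
Proof.
move=> pq; rewrite /E1 (w_edge wit) //=; apply/forallP=> U; apply/implyP=> b.
apply/forallP=> i; apply/implyP=> /andP[/eqP el].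
case/orP=> /andP[/eqP ep /eqP eq_]; apply/eqP.
  exact: e1_edge_oriented.
rewrite addbC; apply: e1_edge_oriented; rewrite // 1?eq_sym // lb_sym //.
Qed.

Lemma phi1_aut f : partial_iso f -> forall a u v, E1 a (phi1 f u) (phi1 f v) = E1 a u v.
Proof.
move=> pf a u v; rewrite !permE /E1 (w_aut wit) //=; congr (_ && _).
have eqU U (i : 'I_n.+1) : bad U -> matches U i u.1 a v.1 ->
  (lift f u).2 (act (phi f) U) (+) (lift f v).2 (act (phi f) U) = u.2 U (+) v.2 U.
  move=> b m; rewrite !lift_act; case: (bad_in b m) => -> -> /=.
  by case: (u.2 U); case: (v.2 U); case: (twist f U).
have mt U (i : 'I_n.+1) :
    matches (act (phi f) U) i (phi f u.1) a (phi f v.1) = matches U i u.1 a v.1.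
  by rewrite /matches lbl_act !vtx_act !(inj_eq perm_inj).
apply/forallP/forallP=> h U.
- apply/implyP=> b; have := h (act (phi f) U); rewrite act_bad // b => /forallP h'.
  apply/forallP=> i; apply/implyP=> m; have := h' i; rewrite mt m /=.
  by rewrite (eqU U i b m).
- rewrite -(actVK (phi f) U); move: (act _ U) => {}U; rewrite act_bad //.
  apply/implyP=> b; have := h U; rewrite b => /forallP h'.
  apply/forallP=> i; apply/implyP; rewrite mt => m; have := h' i; rewrite m /=.
  by rewrite (eqU U i b m).
Qed.

(** By [bad_three_points] the position i must be n, so f is defined at both ends of the last edge
    and preserves its label. The converse below applies this argument to the image of U. *)
Lemma last_in_A_act f U i p q p' q' : partial_iso f -> bad U -> i < n.+1 -> i <> 0 ->
  f p = Some p' -> e p = vtx U 0 -> f q = Some q' -> e q = vtx U i ->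
  last_in_A U -> last_in_A (act (phi f) U).
Proof.
move=> pf b hi i0 fp ep fq eq_ /andP[_ /existsP[r /existsP[s]]].
case/and4P=> /eqP er /eqP es rs /eqP el.
case: (eqVneq i n) => [i_n|/eqP i_n]; last first.
  by case: (bad_three_points b _ _ _ _ _ _ ep eq_ er); lia.
have rq : r = q by apply: (w_inj wit); rewrite er eq_ i_n.
have sp : s = p by apply: (w_inj wit); rewrite es ep.
rewrite /last_in_A act_bad // b; apply/existsP; exists q'; apply/existsP; exists p'.
rewrite !vtx_act lbl_act -er -es rq sp (w_ext wit pf fp) (w_ext wit pf fq) !eqxx /=.
rewrite rq sp in rs el; rewrite (pf.2 _ _ _ _ fq fp rs) el eqxx andbT.
by apply: contraNN rs => /eqP e'; rewrite e' in fq; rewrite (pf.1 _ _ _ fq fp).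
Qed.

Lemma last_in_A_unact f U i p q p' q' : partial_iso f -> bad U -> i < n.+1 -> i <> 0 ->
  f p = Some p' -> e p = vtx U 0 -> f q = Some q' -> e q = vtx U i ->
  last_in_A (act (phi f) U) -> last_in_A U.
Proof.
move=> pf b hi i0 fp ep fq eq_ /andP[_ /existsP[r /existsP[s]]].
rewrite !vtx_act lbl_act; case/and4P=> /eqP er /eqP es rs /eqP el.
have ep' := w_ext wit pf fp; have eq' := w_ext wit pf fq.
case: (eqVneq i n) => [i_n|/eqP i_n]; last first.
  have b' : bad (act (phi f) U) by rewrite act_bad.
  case: (bad_three_points (i := 0) (j := i) (k := n) (p := p') (q := q') (r := r) b');
    rewrite ?vtx_act -?ep -?eq_ ?ep' ?eq' //; lia.
have rq : r = q' by apply: (w_inj wit); rewrite er -i_n -eq_ eq'.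
have sp : s = p' by apply: (w_inj wit); rewrite es -ep ep'.
have qp : q != p by apply: contraNN rs => /eqP h; move: fq; rewrite rq sp h fp => -[->].
rewrite /last_in_A b; apply/existsP; exists q; apply/existsP; exists p.
by rewrite ep eq_ i_n !eqxx qp -el rq sp (pf.2 _ _ _ _ fq fp qp) eqxx.
Qed.

(** At position 0 the twist is exactly the required change. If p lies at another position of U, a
    nonzero twist would need a second point of the domain at position 0, and then [last_in_A] is the
    same for U and its image. *)
Lemma twist_move f U p p' : partial_iso f -> f p = Some p' ->
  (e p' == vtx (act (phi f) U) 0) && last_in_A (act (phi f) U) =
  ((e p == vtx U 0) && last_in_A U) (+) (inU (e p) U && twist f U).
Proof.
move=> pf fp; rewrite vtx_act -(w_ext wit pf fp) (inj_eq perm_inj).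
case: eqP => [e0|ne0] /=.
  have -> : inU (e p) U by apply/existsP; exists ord0; rewrite e0.
  have -> : twist f U = last_in_A U (+) last_in_A (act (phi f) U).
    rewrite /twist; have -> // : [exists p0, (f p0 != None) && (e p0 == vtx U 0)].
    by apply/existsP; exists p; rewrite fp e0 eqxx.
  by case: (last_in_A U); case: (last_in_A _).
apply/esym/negbTE/negP=> /andP[/existsP[i /eqP ei] /andP[/existsP[q /andP[fq /eqP eq_]]]].
case fq': (f q) fq => [q'|] // _.
have i0 : val i <> 0 by move=> i0; apply: ne0; rewrite -ei i0.
case: (boolP (bad U)) => [b|nb_]; last first.
  by rewrite /last_in_A act_bad // (negbTE nb_).
case h1: (last_in_A U); case h2: (last_in_A _) => //= _.
- by move: h2; rewrite (last_in_A_act (i := i) pf b _ i0 fq' eq_ fp (esym ei) h1) // ltn_ord.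
- by move: h1; rewrite (last_in_A_unact (i := i) pf b _ i0 fq' eq_ fp (esym ei) h2) // ltn_ord.
Qed.

Lemma phi1_ext f : partial_iso f -> forall p p', f p = Some p' -> phi1 f (e1 p) = e1 p'.
Proof.
move=> pf p p' fp; rewrite permE.
have eq1 : (lift f (e1 p)).1 = (e1 p').1 by exact: (w_ext wit).
have eq2 : (lift f (e1 p)).2 = (e1 p').2.
  apply/ffunP=> U; rewrite -(actVK (phi f) U); move: (act _ U) => {}U.
  by rewrite lift_act 2!ffunE (twist_move _ pf fp).
by rewrite [LHS]surjective_pairing [RHS]surjective_pairing eq1 eq2.
Qed.

(** The twists of f at U and of g at the image of U share the term [last_in_A (act (phi f) U)],
    which cancels. Since dom f = dom h and range f = dom g, the domain conditions in the three
    twists agree. *)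
Lemma phi1_coh f g h : partial_iso f -> partial_iso g -> partial_iso h ->
  coherent_triple f g h -> forall u, phi1 h u = phi1 g (phi1 f u).
Proof.
move=> pf pg ph coh u; rewrite !permE.
have ch := w_coh wit pf pg ph coh.
have eq1 : (lift h u).1 = (lift g (lift f u)).1 by exact: ch.
have actc U : act (phi h) U = act (phi g) (act (phi f) U).
  case: U => us ls; congr (_, _); apply: val_inj => /=.
  by rewrite -map_comp; apply: eq_map => x /=.
case: coh => dfh rfg _ hE.
have domE U : [exists p, (h p != None) && (e p == vtx U 0)] =
              [exists p, (f p != None) && (e p == vtx U 0)].
  apply: eq_existsb => p; congr (_ && _).
  by have /setP /(_ p) := dfh; rewrite !inE.
have domE' U : [exists p, (g p != None) && (e p == vtx (act (phi f) U) 0)] =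
              [exists p, (f p != None) && (e p == vtx U 0)].
  apply/existsP/existsP=> -[p /andP[gp /eqP ep]].
    have : p \in prange f by rewrite rfg inE.
    rewrite inE => /existsP[q /eqP fq]; exists q; rewrite fq /=.
    by rewrite -(inj_eq (@perm_inj _ (phi f))) (w_ext wit pf fq) ep vtx_act.
  case fp: (f p) gp => [p'|] // _; exists p'.
  rewrite vtx_act -ep (w_ext wit pf fp) eqxx andbT.
  have : p' \in pdom g by rewrite -rfg inE; apply/existsP; exists p; rewrite fp.
  by rewrite inE.
have eq2 : (lift h u).2 = (lift g (lift f u)).2.
  apply/ffunP=> U; rewrite -(actVK (phi h) U); move: (act _ U) => {}U.
  rewrite lift_act actc !lift_act /= inU_act -addbA; congr (_ (+) _).
  rewrite /twist domE domE' -actc; case: (inU _ _) => //=; case: [exists p, _] => //=.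
  by case: (last_in_A U); case: (last_in_A _); case: (last_in_A _).
by rewrite [LHS]surjective_pairing [RHS]surjective_pairing eq1 eq2.
Qed.

Lemma conn1_conn w u v : conn E1 w u v -> conn E w u.1 v.1.
Proof.
elim: w u => [|a w IH] u /=; first by move/eqP->.
case/existsP=> z /andP[/andP[h _] /IH c]; apply/existsP; exists z.1.
by rewrite h.
Qed.

(** A bad closed walk of length n + 1 would project to some U. Its U-coordinate stays constant along
    the first n edges and changes along the last, so the walk cannot close. *)
Lemma no_bad1 : no_bad E1 n.+1.
Proof.
move=> w u; rewrite leq_eqVlt => /orP[/eqP sw|lt] w0 c; last first.
  by apply: (nb (x := u.1)); rewrite // ?(conn1_conn c).
have [v [v0 vn vE]] := conn_vertices c; rewrite sw in vn vE.
have sv : size (mkseq (fun i => (v i).1) n.+2) == n.+2 by rewrite size_mkseq.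
have sw' : size w == n.+1 by rewrite sw.
pose U : cyc := (Tuple sv, Tuple sw').
have vU i : i < n.+2 -> vtx U i = (v i).1 by move=> h; rewrite /vtx nth_mkseq.
apply/negPn/negP=> ng.
have b : bad U.
  rewrite /bad ng andbT !vU // v0 vn eqxx /=; apply/forallP=> i.
  have hi : i.+1 < n.+2 := ltn_ord i.
  rewrite (vU _ (ltnW hi)) (vU _ hi).
  by have := vE (thead U.2) i (ltn_ord i) => /andP[].
have step k : k < n.+1 -> (v k).2 U (+) (v k.+1).2 U = (k == n).
  move=> hi; have := vE (thead U.2) k hi => /andP[_ /forallP/(_ U)].
  rewrite b => /forallP/(_ (Ordinal hi)) /implyP h; apply/eqP; apply: h.
  have hi' : k.+1 < n.+2 := hi.
  by rewrite /matches /= (vU _ (ltnW hi')) (vU _ hi') !eqxx.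
have const i : i <= n -> (v i).2 U = u.2 U.
  elim: i => [|i IH] hi; first by rewrite v0.
  have := step i ltac:(lia); rewrite (IH (ltnW hi)) (ltn_eqF hi).
  by case: (u.2 U); case: ((v i.+1).2 U).
have := step n (ltnSn n); rewrite vn const // addbb eqxx.
by [].
Qed.

Lemma witness1 : witness E1 e1 phi1.
Proof.
split; [exact: E1_sym| |exact: e1_edge|exact: phi1_aut|exact: phi1_ext|exact: phi1_coh].
by move=> p q [/(w_inj wit)].
Qed.

End Step.

Lemma witness0 : witness (fun _ _ _ => true) id (@fill_perm A).
Proof.
split=> //.
  by move=> f [pf _] p p' fp; rewrite fill_permE // /fill fp.
move=> f g h [pf _] [pg _] [ph _] coh x.
by rewrite !fill_permE //; apply: fill_coherent coh.
Qed.

Lemma unwound_witness n :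
  exists (V : finType) (E : lab -> rel V) (e : A -> V) (phi : pfun A -> {perm V}),
    witness E e phi /\ no_bad E n.
Proof.
elim: n => [|n [V [E [e [phi [wit nb]]]]]].
  exists A, (fun _ _ _ => true), id, (@fill_perm A).
  by split; [exact: witness0|case].
exists (V1 V n), (@E1 V E n), (@e1 V E e n), (@phi1 V E e phi n).
by split; [exact: witness1|exact: no_bad1].
Qed.

End Unwinding.

(** * Completion along walks *)

Section Reach.
Variables delta K1 K2 C0 C1 M : nat.
Hypothesis magicM : magic delta K1 K2 C0 C1 M.
Local Notation tri := (tri delta K1 K2 C0 C1).

(* Distances s, ..., t from some base point to the vertices of a walk labelled w.
   The ordinal a in 'I_delta stands for the distance a.+1. *)
Fixpoint reach (w : seq 'I_delta) (s t : nat) : bool :=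
  if w is a :: w' then [exists r : 'I_delta.+1, tri s a.+1 r && reach w' r t] else s == t.

Lemma reach_consP (a : 'I_delta) w s t :
  reflect (exists2 r, tri s a.+1 r & reach w r t) (reach (a :: w) s t).
Proof.
apply: (iffP existsP) => [[r /andP[h1 h2]]|[r h1 h2]]; first by exists r.
have [_ _ rd] := tri_le h1.
by exists (Ordinal (rd : r < delta.+1)); rewrite /= h1.
Qed.

Lemma reach_catP w1 w2 s t :
  reflect (exists2 r, reach w1 s r & reach w2 r t) (reach (w1 ++ w2) s t).
Proof.
elim: w1 s => [|a w1 IH] s /=.
  by apply: (iffP idP) => [h|[r /eqP ->] //]; exists s => /=.
apply: (iffP (reach_consP _ _ _ _)) => [[r h1 /IH[q h2 h3]]|[q /reach_consP[r h1 h2] h3]].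
  by exists q => //; apply/reach_consP; exists r.
by exists r => //; apply/IH; exists q.
Qed.

Lemma tri00 s : s <= delta -> tri s 0 s.
Proof. by move=> h; rewrite triCl (tri0 magicM) h eqxx. Qed.

(** By [flip] a fan of triangles from a distant base point can be exchanged for a fan from the start
    of the walk and one further triangle. This is the independence of the triangulation. *)
Lemma reachE w s t : s <= delta ->
  reach w s t <-> exists2 x, reach w 0 x & tri s x t.
Proof.
elim: w s t => [|a w IH] s t sd /=.
  split=> [/eqP <-|[x /eqP <-]]; first by exists 0; rewrite ?tri00.
  by rewrite triCl (tri0 magicM) => /andP[_ /eqP ->].
have ad : a.+1 <= delta := ltn_ord a.
split=> [/reach_consP[r h1]|[x /reach_consP[r]]].
  have [_ _ rd] := tri_le h1.
  case/(IH _ _ rd)=> x h2 h3.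
  have [d h4 h5] : exists2 d, tri s t d & tri d x a.+1.
    by apply: (flip magicM (b := r)); rewrite triCr.
  exists d; last by rewrite triCr.
  apply/reach_consP; exists a.+1; first by rewrite (tri0 magicM) ad eqxx.
  by apply/(IH _ _ ad); exists x => //; rewrite tri_rev.
rewrite (tri0 magicM) => /andP[_ /eqP <-] /(IH _ _ ad)[y h1 h2] h3.
have [d h4 h5] : exists2 d, tri s a.+1 d & tri d y t.
  by apply: (flip magicM (b := x)) => //; rewrite tri_rot.
have [_ _ dd] := tri_le h4.
by apply/reach_consP; exists d => //; apply/(IH _ _ dd); exists y.
Qed.

Definition good (w : seq 'I_delta) : bool := reach w 0 0.

Lemma reach_le w x : reach w 0 x -> x <= delta.
Proof.
by case/(reachE _ _ (leq0n _))=> y _; rewrite (tri0 magicM) => /andP[h /eqP <-].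
Qed.

Lemma reach_back w x : x <= delta -> reach w x 0 = reach w 0 x.
Proof.
move=> xd; apply/idP/idP=> [/(reachE _ _ xd)[y h]|h].
  by rewrite tri_rev (tri0 magicM) => /andP[_ /eqP <-].
by apply/(reachE _ _ xd); exists x => //; rewrite tri_rev (tri0 magicM) xd eqxx.
Qed.

Lemma good_catP w1 w2 : reflect (exists2 r, reach w1 0 r & reach w2 0 r) (good (w1 ++ w2)).
Proof.
apply: (iffP (reach_catP _ _ _ _)) => -[r h1 h2]; exists r => //;
  by rewrite ?reach_back // in h2 *; apply: reach_le h1.
Qed.

Lemma good_rotation w1 w2 : good (w1 ++ w2) -> good (w2 ++ w1).
Proof. by case/good_catP=> r h1 h2; apply/good_catP; exists r. Qed.

Lemma reach1 a x : reach [:: a] 0 x = (x == a.+1).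
Proof.
have ad : a.+1 <= delta := ltn_ord a.
apply/reach_consP/eqP=> [[r]|->].
  by rewrite (tri0 magicM) => /andP[_ /eqP <-] /= /eqP.
by exists a.+1; rewrite ?(tri0 magicM) ?ad /= eqxx.
Qed.

Lemma good_double a : good [:: a; a].
Proof. by apply/(good_catP [:: a] [:: a]); exists a.+1; rewrite reach1. Qed.

Lemma good_rcons w a : good (rcons w a) = reach w 0 a.+1.
Proof.
rewrite -cats1; apply/good_catP/idP=> [[r h]|h]; last by exists a.+1; rewrite ?reach1.
by rewrite reach1 => /eqP <-.
Qed.

Lemma good_cat3P w1 w2 w3 : reflect
  (exists x y z, [/\ reach w1 0 x, reach w2 0 y, reach w3 0 z & tri x y z])
  (good (w1 ++ w2 ++ w3)).
Proof.
apply: (iffP (reach_catP _ _ _ _)) => [[x h1]|[x [y [z [h1 h2 h3 t]]]]].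
  have xd := reach_le h1.
  case/reach_catP=> z /(reachE _ _ xd)[y h2 t]; have [_ _ zd] := tri_le t.
  by rewrite reach_back // => h3; exists x, y, z.
have [xd yd zd] := tri_le t.
exists x => //; apply/reach_catP; exists z; last by rewrite reach_back.
by apply/(reachE _ _ xd); exists y.
Qed.

End Reach.

(** * The metric completion of a labelled graph without short bad walks *)

Section Completion.
Variables delta K1 K2 C0 C1 M : nat.
Hypothesis magicM : magic delta K1 K2 C0 C1 M.
Local Notation tri := (tri delta K1 K2 C0 C1).
Local Notation op := (op C0 C1 M).
Local Notation rank := (rank delta M).
Local Notation approx := (approx delta K1 K2 C0 C1 M).
Local Notation below := (below delta K1 C0 C1 M).
Local Notation reach := (@reach delta K1 K2 C0 C1).
Local Notation good := (@good delta K1 K2 C0 C1).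

Lemma rank_op a b : 0 < a <= delta -> 0 < b <= delta -> op a b <> M ->
  [/\ a <> M, b <> M, rank a < rank (op a b) & rank b < rank (op a b)].
Proof.
case: magicM => d3 [K1p K1M MK2 Md] [dM MC dC] _ _.
move=> /andP[a0 ad] /andP[b0 bd] ne.
case: (rankP delta M a) (rankP delta M b) (rankP delta M (op a b))
  => [] [ha ->] [] [hb ->] [] [ho ->];
  move: ne ho; case: (opP magicM ad bd); try lia; move=> *; split; lia.
Qed.

Lemma rank_le x : 0 < x -> x <> M -> rank x <= 2 * delta.
Proof.
case: magicM => d3 [K1p K1M MK2 Md] _ _ _ x0 xM.
by case: (rankP delta M x) => [] [hx ->]; lia.
Qed.

(** On one side of M this is the order of ranks. On opposite sides the values contradict each other,
    except that M - 1 in the exceptional case yields to a value above M. *)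
Lemma below_of_approx r x y : 0 < x <= delta -> 0 < y <= delta -> x <> M -> y <> M ->
  rank x <= rank y -> approx r x -> approx r y -> below x y.
Proof.
case: magicM => d3 [K1p K1M MK2 Md] [dM MC dC] _ _.
move=> x0 y0 xM yM rk /(_ xM)[ax1 ax2 _ _] /(_ yM)[ay1 ay2 _ _].
move: rk; case: (rankP delta M x) => [] [hx ->]; case: (rankP delta M y) => [] [hy ->] rk; try lia.
- by split=> [_|]; [left; lia|lia].
- split; [by lia|move=> _]; have ry := ay2 hy; case: (ax1 hx) => [|[exc ex]]; first lia.
  by case: (exceptionalE magicM exc); lia.
- split; [move=> _|by lia]; have rx := ax2 hx; case: (ay1 hy) => [|[exc ex]]; first lia.
  by right; split.
- by split=> [|_]; lia.
Qed.

Lemma approx_edge a x : 0 < a <= delta -> 0 < x <= delta -> x <> M ->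
  approx a x -> rank x <= rank a -> x = a.
Proof.
case: magicM => d3 [K1p K1M MK2 Md] [dM MC dC] _ _.
move=> a0 x0 xM /(_ xM)[ax1 ax2 _ ax4].
have lt : x < M -> a <= x \/ (exceptional_II delta K1 K2 C0 C1 M /\ x.+1 = M).
  by move=> hx; case: (ax1 hx) => [|[/(exceptionalE magicM)]]; [left|right].
have par : x < K1 -> exists k, a + x = k + k.
  by move=> hx; apply: evenE; apply: ax4; [lia|left].
clear ax1 ax4.
case: (rankP delta M x) => [] [hx ->]; case: (rankP delta M a) => [] [ha ->] rk;
  try (by lia); (case: (lt hx) => [|[[? ? ? ? ?] ?]]; first by lia); try (by lia).
by case: (par ltac:(lia)) => k; lia.
Qed.

Section Graph.
Variables (V : finType) (E : 'I_delta -> rel V).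
Hypothesis E_sym : forall a x y, E a x y = E a y x.

(* der k u v x: the value x is obtained for u, v by nesting op at most k times. *)
Fixpoint der (k : nat) (u v : V) (x : nat) : bool :=
  if k is k'.+1 then
    der k' u v x ||
    [exists z, exists a : 'I_delta.+1, exists b : 'I_delta.+1,
      [&& der k' u z a, der k' z v b & x == op a b]]
  else [exists a : 'I_delta, (a.+1 == x) && E a u v].

Lemma derSP k u v x : reflect
  (der k u v x \/
   exists z (a b : 'I_delta.+1), [/\ der k u z a, der k z v b & x = op a b])
  (der k.+1 u v x).
Proof.
apply: (iffP orP) => -[h|h]; [by left|right|by left|right].
  by case/existsP: h => z /existsP[a /existsP[b /and3P[h1 h2 /eqP h3]]]; exists z, a, b.
case: h => z [a [b [h1 h2 h3]]]; apply/existsP; exists z; apply/existsP; exists a.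
by apply/existsP; exists b; apply/and3P; rewrite h3.
Qed.

Lemma der_bounds k u v x : der k u v x -> 0 < x <= delta.
Proof.
elim: k u v x => [|k IH] u v x.
  by case/existsP=> a /andP[/eqP <- _]; have := ltn_ord a.
by case/derSP=> [/IH //|[z [a [b [/IH ha /IH hb ->]]]]]; apply: (op_bounds magicM).
Qed.

Lemma der_mono k l u v x : k <= l -> der k u v x -> der l u v x.
Proof.
move=> /subnKC <-; elim: (l - k) => [|d IH] h; first by rewrite addn0.
by rewrite addnS; apply/derSP; left; apply: IH.
Qed.

(** Both arguments of an [op] with value other than M have smaller rank, so the rank bounds the
    nesting needed. *)
Lemma der_rank k u v x : der k u v x -> x <> M -> der (rank x) u v x.
Proof.
elim: k u v x => [|k IH] u v x; first by move=> h _; apply: der_mono h.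
case/derSP=> [/IH //|[z [a [b [ha hb ->]]]]] ne.
have [aM bM ra rb] := rank_op (der_bounds ha) (der_bounds hb) ne.
case: (rank (op a b)) ra rb => // r ra rb.
by apply/derSP; right; exists z, a, b; split=> //;
  [apply: der_mono (IH _ _ _ ha aM)|apply: der_mono (IH _ _ _ hb bM)].
Qed.

Definition derived := der (2 * delta).

Lemma derived_bounds u v x : derived u v x -> 0 < x <= delta.
Proof. exact: der_bounds. Qed.

Lemma derived_op u v z a b : derived u z a -> derived z v b -> op a b <> M ->
  derived u v (op a b).
Proof.
move=> ha hb ne; have a0 := derived_bounds ha; have b0 := derived_bounds hb.
have o0 := op_bounds magicM a0 b0.
apply: (@der_mono (rank (op a b))).
  by apply: rank_le ne; case/andP: o0.
apply: (@der_rank (2 * delta).+1) => //; apply/derSP; right.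
have [ad bd] : a < delta.+1 /\ b < delta.+1 by lia.
by exists z, (Ordinal ad), (Ordinal bd).
Qed.

Lemma derived_edge (a : 'I_delta) u v : E a u v -> derived u v a.+1.
Proof.
move=> h; apply: (@der_mono 0) => //; apply/existsP; exists a.
by rewrite eqxx.
Qed.

Lemma der_sym k u v x : der k u v x = der k v u x.
Proof.
elim: k u v x => [|k IH] u v x; first by apply: eq_existsb => a; rewrite E_sym.
rewrite /= IH; congr (_ || _); apply: eq_existsb => z.
apply/existsP/existsP=> -[a /existsP[b /and3P[h1 h2 h3]]];
  by exists b; apply/existsP; exists a; rewrite IH h2 IH h1 opC.
Qed.

(** Nested [op] corresponds to concatenated walks. The length bound doubles with each unit of rank
    because both arguments have smaller rank. *)
Lemma der_word k u v x : der k u v x -> x <> M -> exists w,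
  [/\ 0 < size w, size w <= 2 ^ rank x, conn E w u v & forall r, reach w 0 r -> approx r x].
Proof.
elim: k u v x => [|k IH] u v x.
  case/existsP=> a /andP[/eqP <- h] _; exists [:: a]; split=> //.
  - by rewrite expn_gt0.
  - by apply/existsP; exists v; rewrite h /=.
  - by move=> r; rewrite (reach1 magicM) => /eqP ->; apply: approx_refl.
case/derSP=> [/IH //|[z [a [b [ha hb ->]]]]] ne.
have [aM bM ra rb] := rank_op (der_bounds ha) (der_bounds hb) ne.
have [w1 [s1 l1 c1 r1]] := IH _ _ _ ha aM.
have [w2 [s2 l2 c2 r2]] := IH _ _ _ hb bM.
exists (w1 ++ w2); split.
- by rewrite size_cat addn_gt0 s1.
- rewrite size_cat; case: (rank (op a b)) ra rb => // r ra rb.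
  rewrite expnS mul2n -addnn; apply: leq_add.
    by apply: leq_trans l1 _; rewrite leq_exp2l.
  by apply: leq_trans l2 _; rewrite leq_exp2l.
- exact: conn_cat c1 c2.
- move=> r /reach_catP[s h1]; have sd := reach_le magicM h1.
  case/(reachE magicM _ _ sd)=> t h2 h3.
  apply: (approx_op magicM (der_bounds ha) (der_bounds hb) _ (r1 _ h1) (r2 _ h2)).
  by rewrite tri_rot.
Qed.

Lemma derived_word u v x : derived u v x -> x <> M -> exists w,
  [/\ 0 < size w, size w <= 2 ^ (2 * delta), conn E w u v &
      forall r, reach w 0 r -> approx r x].
Proof.
move=> h ne; have [w [s0 s1 c r]] := der_word h ne; exists w; split=> //.
apply: leq_trans s1 _; rewrite leq_exp2l //; apply: rank_le ne.
by case/andP: (derived_bounds h).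
Qed.

Hypothesis nb : no_bad good E (3 * 2 ^ (2 * delta)).

Definition magic_ord : 'I_delta.+1 := inord M.

Lemma magic_ordE : magic_ord = M :> nat.
Proof. by rewrite inordK //; case: magicM => _ []; lia. Qed.

(** M is always present but has the largest rank, so it is chosen only when no other value is
    derived. *)
Definition dvals u v : {set 'I_delta.+1} :=
  [set x : 'I_delta.+1 | derived u v x || (x == magic_ord)].

Definition dbar u v : nat :=
  if u == v then 0 else [arg min_(x < magic_ord in dvals u v) rank x].

Lemma dbarP u v : u != v ->
  [/\ 0 < dbar u v <= delta, dbar u v <> M -> derived u v (dbar u v) &
      forall y, derived u v y -> rank (dbar u v) <= rank y].
Proof.
rewrite /dbar => /negbTE ->.
case: arg_minnP => [|x]; first by rewrite inE eqxx orbT.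
rewrite inE => hx hmin; split.
- case/orP: hx => [/derived_bounds //|/eqP ->]; rewrite magic_ordE.
  by case: magicM => _ []; lia.
- by case/orP: hx => // /eqP -> /(_ magic_ordE).
- move=> y hy; have /andP[_ yd] := derived_bounds hy.
  by have := hmin (Ordinal (yd : y < delta.+1)); rewrite inE hy => /(_ isT).
Qed.

Lemma rankM : rank M = (2 * delta).+1.
Proof. by rewrite /rank eqxx. Qed.

Lemma dbar_neqM u v y : u != v -> derived u v y -> y <> M -> dbar u v <> M.
Proof.
move=> uv hy yM eM; have [_ _ /(_ _ hy)] := dbarP uv.
rewrite eM rankM ltnNge rank_le //.
by case/andP: (derived_bounds hy).
Qed.

Lemma expn3 : 2 ^ (2 * delta) + (2 ^ (2 * delta) + 2 ^ (2 * delta)) = 3 * 2 ^ (2 * delta).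
Proof. lia. Qed.

(** The words of the two values form a short closed walk, whose goodness supplies one distance r
    approximated by both. *)
Lemma below_dbar u v y : u != v -> derived u v y -> below (dbar u v) y.
Proof.
move=> uv hy; have [e|/eqP yM] := eqVneq y M; first by rewrite e; split; rewrite ltnn.
have [d0 dd dmin] := dbarP uv; have dM := dbar_neqM uv hy yM.
have [w1 [s1 l1 c1 r1]] := derived_word (dd dM) dM.
have hy' : derived v u y by rewrite /derived der_sym.
have [w2 [s2 l2 c2 r2]] := derived_word hy' yM.
have : good (w1 ++ w2).
  apply: (nb _ _ (conn_cat c1 c2)); rewrite size_cat ?addn_gt0 ?s1 //.
  by rewrite -expn3; lia.
case/(good_catP magicM)=> r /r1 a1 /r2 a2.
by apply: below_of_approx a1 a2; rewrite ?(derived_bounds hy) // dmin.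
Qed.

Lemma dbar_edge (a : 'I_delta) u v : u != v -> E a u v -> dbar u v = a.+1.
Proof.
move=> uv h; have hy := derived_edge h.
have [d0 dd dmin] := dbarP uv; have ad : 0 < a.+1 <= delta := ltn_ord a.
have [e|/eqP dM] := eqVneq (dbar u v) M.
  apply/eqP/negPn/negP; rewrite e => /eqP ne.
  by case: (dbar_neqM uv hy) => // e'; apply: ne.
have [w1 [s1 l1 c1 r1]] := derived_word (dd dM) dM.
have c2 : conn E [:: a] v u by apply/existsP; exists u; rewrite E_sym h /=.
have : good (w1 ++ [:: a]).
  apply: (nb _ _ (conn_cat c1 c2)); rewrite size_cat ?addn_gt0 ?s1 //=.
  by rewrite -expn3; apply: leq_add => //; rewrite addn_gt0 expn_gt0.
case/(good_catP magicM)=> r /r1 a1; rewrite (reach1 magicM) => /eqP er.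
by rewrite er in a1; apply: approx_edge a1 _; rewrite ?dmin.
Qed.

Lemma dbar_sym u v : dbar u v = dbar v u.
Proof.
rewrite /dbar eq_sym; have -> // : dvals u v = dvals v u.
by apply/setP=> x; rewrite !inE /derived der_sym.
Qed.

Lemma dbar_below u v w : u != v -> v != w -> u != w -> below (dbar u v) (op (dbar v w) (dbar u w)).
Proof.
move=> uv vw uw.
have [e|/eqP oM] := eqVneq (op (dbar v w) (dbar u w)) M; first by rewrite e; split; rewrite ltnn.
have [d0 dd _] := dbarP vw; have [d0' dd' _] := dbarP uw.
have [yM zM _ _] := rank_op d0 d0' oM.
apply: below_dbar => //; rewrite opC; apply: (derived_op (dd' zM)).
  by rewrite /derived der_sym; apply: dd.
by rewrite opC.
Qed.

(** If no side is M, the words of the three sides form a short closed walk, and its goodness yields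
    the realizing triangle. *)
Lemma dbar_tri u v w : u != v -> v != w -> u != w -> tri (dbar u v) (dbar v w) (dbar u w).
Proof.
move=> uv vw uw.
have [d1 dd1 _] := dbarP uv; have [d2 dd2 _] := dbarP vw; have [d3 dd3 _] := dbarP uw.
apply: (tri_of_below magicM) => //.
- exact: dbar_below.
- rewrite (dbar_sym u v) (dbar_sym u w) opC; apply: dbar_below; by rewrite // eq_sym.
- rewrite (dbar_sym v w) opC; apply: dbar_below; by rewrite // eq_sym.
move=> xM yM zM.
have [w1 [s1 l1 c1 r1]] := derived_word (dd1 xM) xM.
have [w2 [s2 l2 c2 r2]] := derived_word (dd2 yM) yM.
have h3 : derived w u (dbar u w) by rewrite /derived der_sym; apply: dd3.
have [w3 [s3 l3 c3 r3]] := derived_word h3 zM.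
have : good (w1 ++ w2 ++ w3).
  apply: (nb _ _ (conn_cat c1 (conn_cat c2 c3))); rewrite !size_cat ?addn_gt0 ?s1 //.
  by rewrite -expn3; lia.
case/(good_cat3P magicM)=> x [y [z [h1 h2 h4 t]]].
by exists x, y, z; split; auto.
Qed.

Lemma der_aut (s : {perm V}) : (forall a x y, E a (s x) (s y) = E a x y) ->
  forall k u v x, der k (s u) (s v) x = der k u v x.
Proof.
move=> aut; elim=> [|k IH] u v x; first by apply: eq_existsb => a; rewrite aut.
rewrite /= IH; congr (_ || _); apply/existsP/existsP=> -[z h].
  exists ((s^-1)%g z); move: h; rewrite -{1 2}(permKV s z).
  by under eq_existsb => a do under eq_existsb => b do rewrite !IH.
by exists (s z); under eq_existsb => a do under eq_existsb => b do rewrite !IH.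
Qed.

Lemma dbar_aut (s : {perm V}) : (forall a x y, E a (s x) (s y) = E a x y) ->
  forall u v, dbar (s u) (s v) = dbar u v.
Proof.
move=> aut u v; rewrite /dbar (inj_eq perm_inj); have -> // : dvals (s u) (s v) = dvals u v.
by apply/setP=> x; rewrite !inE /derived der_aut.
Qed.

Lemma dbar_eq0 u v : dbar u v = 0 <-> u = v.
Proof.
split=> [h|->]; last by rewrite /dbar eqxx.
by apply/eqP/negPn/negP=> uv; have [] := dbarP uv; rewrite h.
Qed.

Lemma dbar_triangle u v w : dbar u w <= dbar u v + dbar v w.
Proof.
have [->|uv] := eqVneq u v; first by rewrite leq_addl.
have [<-|vw] := eqVneq v w; first by rewrite leq_addr.
have [<-|uw] := eqVneq u w; first by rewrite (_ : dbar u u = 0) //; apply/dbar_eq0.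
by case: (tri_elim (dbar_tri uv vw uw)) => _ [].
Qed.

Definition completion : finMetric := FinMetric dbar_eq0 dbar_sym dbar_triangle.

End Graph.
End Completion.

(** * Spaces of the class as labelled complete graphs *)

Section ClassA.
Variables delta K1 K2 C0 C1 M : nat.
Hypothesis magicM : magic delta K1 K2 C0 C1 M.
Local Notation tri := (tri delta K1 K2 C0 C1).

Lemma tri_triangle_ok a b c : tri a b c -> triangle_ok K1 K2 C0 C1 a b c.
Proof.
case/and4P=> _ _ od ev; split=> h; last by rewrite h in ev.
by move: od; rewrite h => /and5P[? ? ? ? ?]; split=> //; lia.
Qed.

Lemma triangle_ok_tri a b c :
  [/\ a <= delta, b <= delta & c <= delta] ->
  [/\ a <= b + c, b <= a + c & c <= a + b] ->
  triangle_ok K1 K2 C0 C1 a b c -> tri a b c.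
Proof.
move=> /and3P h1 /and3P h2 [od ev]; apply/and4P; split=> //; apply/implyP=> // h.
by case: (od h) => h3 h4 h5; rewrite h3 h5 /=; lia.
Qed.

Variable A : finMetric.
Hypothesis hA : class_A delta K1 K2 C0 C1 A.
Implicit Types p q r : A.

Lemma dist_diag p : dist p p = 0. Proof. exact/dist_eq0. Qed.

Lemma dist_le p q : dist p q <= delta.
Proof.
have [->|/eqP pq] := eqVneq p q; first by rewrite dist_diag.
by case/andP: (hA.1 _ _ pq).
Qed.

Lemma dist_gt0 p q : p != q -> 0 < dist p q.
Proof. by move=> /eqP pq; case/andP: (hA.1 _ _ pq). Qed.

Lemma class_tri p q r : tri (dist p q) (dist q r) (dist p r).
Proof.
have [->|/eqP pq] := eqVneq p q.
  by rewrite dist_diag (tri0 magicM) dist_le eqxx.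
have [->|/eqP qr] := eqVneq q r.
  by rewrite dist_diag triCl (tri0 magicM) dist_le eqxx.
have [->|/eqP pr] := eqVneq p r.
  by rewrite dist_diag tri_rev (tri0 magicM) dist_le dist_sym eqxx.
apply: triangle_ok_tri; [by rewrite !dist_le| |exact: hA.2].
split; last exact: dist_triangle.
- by rewrite addnC (dist_sym q r) dist_triangle.
- by rewrite (dist_sym p q) dist_triangle.
Qed.

Lemma delta_gt0 : 0 < delta. Proof. by case: magicM => d3 _ _ _ _; lia. Qed.

(** Labels are distances shifted by one. The diagonal gets the meaningless label 0, hence the
    conditions [p != q] elsewhere. *)
Definition lb p q : 'I_delta := insubd (Ordinal delta_gt0) (dist p q).-1.

Lemma lbE p q : p != q -> (lb p q).+1 = dist p q.
Proof.
move=> pq; have h1 := dist_gt0 pq; have h2 := dist_le p q.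
by rewrite val_insubd; case: ifP; lia.
Qed.

Local Notation good := (@good delta K1 K2 C0 C1).

Lemma arc_reach w p q : arc_good lb good w p q -> reach K1 K2 C0 C1 w 0 (dist p q).
Proof.
rewrite /arc_good; have [->|pq] := eqVneq p q; first by rewrite dist_diag.
by rewrite (good_rcons magicM) lbE.
Qed.

Lemma glue_arcs w1 w2 w3 p q r : arc_good lb good w1 p q -> arc_good lb good w2 q r ->
  arc_good lb good w3 r p -> good (w1 ++ w2 ++ w3).
Proof.
move=> /arc_reach h1 /arc_reach h2 /arc_reach h3; apply/(good_cat3P magicM).
exists (dist p q), (dist q r), (dist r p); split=> //.
by rewrite (dist_sym r p) class_tri.
Qed.

Lemma partial_automorphism_iso f : partial_automorphism f -> partial_iso lb f.
Proof.
case=> pf df; split=> // p q p' q' fp fq pq.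
by rewrite /lb (df _ _ _ _ fp fq).
Qed.

End ClassA.

Theorem theorem4p29 (delta K1 K2 C0 C1 : nat)
    (hadm : primitive_admissible delta K1 K2 C0 C1) :
  coherent_EPPA (class_A delta K1 K2 C0 C1).
Proof.
have [M magicM] := magic_exists hadm; move=> A hA.
have lb_sym (p q : A) : lb magicM p q = lb magicM q p by rewrite /lb dist_sym.
(* The length covers closed walks made of three words, one per side of a triangle, each of length at
   most 2 ^ (2 delta). *)
have [V [E [e [phi [wit nb]]]]] := unwound_witness lb_sym (good_rotation magicM)
  (good_double magicM) (glue_arcs (magicM := magicM) hA) (3 * 2 ^ (2 * delta)).
have E_sym := w_sym wit.
pose B := completion magicM E_sym nb.
have iso f : partial_automorphism f -> partial_iso (lb magicM (A := A)) f.
  exact: partial_automorphism_iso.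
exists B, e, phi; split.
- split=> [x y /eqP xy|x y z /eqP xy /eqP yz /eqP xz].
    by case: (dbarP magicM E xy).
  by apply: tri_triangle_ok; apply: (dbar_tri magicM E_sym nb).
- split=> [|p q]; first exact: w_inj wit.
  have [->|pq] := eqVneq p q; first by rewrite !dist_diag.
  have h := w_edge wit pq.
  rewrite -(lbE magicM hA pq); apply: (dbar_edge magicM E_sym nb) h.
  by rewrite (inj_eq (w_inj wit)).
- move=> f /iso pf; split=> [x y|p p' fp]; first exact: dbar_aut (w_aut wit pf) x y.
  exact: (w_ext wit pf fp).
- move=> f g h /iso pf /iso pg /iso ph coh.
  have ch := w_coh wit pf pg ph coh.
  have dom (s : {perm B}) : pdom (total_pfun s) = setT by apply/setP=> x; rewrite !inE ffunE.
  have ran (s : {perm B}) : prange (total_pfun s) = setT.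
    apply/setP=> x; rewrite !inE; apply/existsP; exists ((s^-1)%g x).
    by rewrite ffunE permKV.
  split; rewrite ?dom ?ran //.
  by apply/ffunP=> x; rewrite !ffunE /= ffunE ch.
Qed.
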